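(* Let $A$ and $B$ be arrays of $n$ real numbers, each sorted in non-increasing order, and let $k$ be an integer with $1 \le k \le n^2$. Consider the multiset of pairwise sums $A+B = \{A[i]+B[j] : 1 \le i,j \le n\}$ (indexed by pairs $(i,j)$). There is an algorithm (the prune-and-search procedure MAX\_SUM\_CROSS-1 of the paper) that, given random access to $A$ and $B$, finds the $k$ largest elements of $A+B$ (the $k$ pairs $(i,j)$ with the largest values $A[i]+B[j]$, ties broken arbitrarily) in $O(\sqrt{k}\log^{3} k)$ time. The output is represented implicitly, as a staircase submatrix of the matrix $M[i,j]=A[i]+B[j]$, and the $k$ sums can be reported explicitly with an additional $O(k)$ time.
   Context: Computation model: real RAM, where reading an array entry, an addition, or a comparison of reals takes $O(1)$ time. The matrix $M$ with $M[i,j]=A[i]+B[j]$ is never stored; its entries are computed on demand. A staircase submatrix of $M$ is a set of entries described by, for each of a set of consecutive rows and columns, a start index and an end index (contiguous ranges), such that for a row (column) $i+1$ its start index is no larger than that of row (column) $i$ and its end index is no larger than that of row (column) $i$; an implicit representation of the $k$ largest elements means such a description, of size $O(\sqrt{k})$, whose entries are exactly the $k$ selected pairs (up to the specified handling of ties). *)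

(* Defs.v *)
From Stdlib Require Import Reals List Arith.
Import ListNotations.
Open Scope R_scope.

(* A real-RAM machine model.                                           *)
(* Two register files: natural-number registers N[.] and real          *)
(* registers Rg[.], both unbounded and indirectly addressable.         *)
(* The arrays A, B are accessed via oracle instructions (0-indexed).   *)
(* Every executed instruction costs one time unit.                     *)

Inductive instr : Type :=
| NConst (d c : nat)
| NAdd (d a b : nat)
| NSub (d a b : nat)          (* N[d] := N[a] - N[b] (truncated)   *)
| NMul (d a b : nat)
| NDiv (d a b : nat)          (* N[d] := N[a] / N[b] (x/0 = 0)     *)
| NLoad (d a : nat)
| NStore (a s : nat)
| RLoad (d a : nat)
| RStore (a s : nat)
| ReadA (d i : nat)
| ReadB (d i : nat)
| RAdd (d a b : nat)
| RSub (d a b : nat)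
| JNLt (a b tgt : nat)
| JRLt (a b tgt : nat)
| Out (a b v : nat)
| Halt.

Definition program := list instr.

Record state : Type := mkState {
  pc : nat;
  nm : nat -> nat;
  rm : nat -> R;
  out : list (nat * nat * R)
}.

Definition upd {X : Type} (f : nat -> X) (a : nat) (v : X) : nat -> X :=
  fun x => if Nat.eqb x a then v else f x.

Definition step (P : program) (A B : nat -> R) (s : state) : state :=
  let '(mkState p N Rg o) := s in
  let nx := S p in
  match nth_error P p with
  | None => s
  | Some Halt => s
  | Some (NConst d c) => mkState nx (upd N d c) Rg o
  | Some (NAdd d a b) => mkState nx (upd N d (N a + N b)%nat) Rg o
  | Some (NSub d a b) => mkState nx (upd N d (N a - N b)%nat) Rg o
  | Some (NMul d a b) => mkState nx (upd N d (N a * N b)%nat) Rg o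
  | Some (NDiv d a b) => mkState nx (upd N d (Nat.div (N a) (N b))) Rg o
  | Some (NLoad d a) => mkState nx (upd N d (N (N a))) Rg o
  | Some (NStore a s') => mkState nx (upd N (N a) (N s')) Rg o
  | Some (RLoad d a) => mkState nx N (upd Rg d (Rg (N a))) o
  | Some (RStore a s') => mkState nx N (upd Rg (N a) (Rg s')) o
  | Some (ReadA d i) => mkState nx N (upd Rg d (A (N i))) o
  | Some (ReadB d i) => mkState nx N (upd Rg d (B (N i))) o
  | Some (RAdd d a b) => mkState nx N (upd Rg d (Rg a + Rg b)) o
  | Some (RSub d a b) => mkState nx N (upd Rg d (Rg a - Rg b)) o
  | Some (JNLt a b t) => mkState (if Nat.ltb (N a) (N b) then t else nx) N Rg o
  | Some (JRLt a b t) =>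
      mkState (if Rlt_dec (Rg a) (Rg b) then t else nx) N Rg o
  | Some (Out a b v) => mkState nx N Rg (o ++ [(N a, N b, Rg v)])
  end.

Fixpoint run (P : program) (A B : nat -> R) (t : nat) (s : state) : state :=
  match t with
  | O => s
  | S t' => run P A B t' (step P A B s)
  end.

Definition halted (P : program) (s : state) : Prop :=
  match nth_error P (pc s) with
  | None => True
  | Some Halt => True
  | Some _ => False
  end.

Definition init (n k : nat) : state :=
  mkState 0 (fun r => if Nat.eqb r 0 then n else if Nat.eqb r 1 then k else 0%nat)
          (fun _ => 0) [].

(* Start a second program on the memory left by a first one. *)
Definition restart (s : state) : state := mkState 0 (nm s) (rm s) [].

(* Implicit (staircase) output encoding in the N-registers:           *)
(*  N[2] = first described row r0,    N[3] = number of rows nr,       *)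
(*  N[4] = first described column c0, N[5] = number of columns nc,    *)
(*  N[6] = base address RB of row ranges, N[7] = base CB of columns.  *)
(*  Row r0+t (t < nr) covers columns N[RB+2t] .. N[RB+2t+1];          *)
(*  column c0+t (t < nc) covers rows N[CB+2t] .. N[CB+2t+1].          *)
(* The described set is the union of all these cells (0-indexed).     *)

Definition st_r0 (s : state) := nm s 2.
Definition st_nr (s : state) := nm s 3.
Definition st_c0 (s : state) := nm s 4.
Definition st_nc (s : state) := nm s 5.
Definition row_start (s : state) (t : nat) := nm s (nm s 6 + 2 * t)%nat.
Definition row_end (s : state) (t : nat) := nm s (nm s 6 + 2 * t + 1)%nat.
Definition col_start (s : state) (t : nat) := nm s (nm s 7 + 2 * t)%nat.
Definition col_end (s : state) (t : nat) := nm s (nm s 7 + 2 * t + 1)%nat.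

Definition stair_set (s : state) (i j : nat) : Prop :=
  (exists t, (t < st_nr s)%nat /\ i = (st_r0 s + t)%nat /\
             (row_start s t <= j <= row_end s t)%nat) \/
  (exists t, (t < st_nc s)%nat /\ j = (st_c0 s + t)%nat /\
             (col_start s t <= i <= col_end s t)%nat).

Definition staircase_wf (s : state) : Prop :=
  (forall t, (S t < st_nr s)%nat ->
     (row_start s (S t) <= row_start s t)%nat /\ (row_end s (S t) <= row_end s t)%nat) /\
  (forall t, (S t < st_nc s)%nat ->
     (col_start s (S t) <= col_start s t)%nat /\ (col_end s (S t) <= col_end s t)%nat).

Definition sorted_noninc (n : nat) (A : nat -> R) : Prop :=
  forall i j, (i <= j < n)%nat -> A j <= A i.

Definition is_topk (n k : nat) (A B : nat -> R) (S : nat -> nat -> Prop) : Prop :=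
  (forall i j, S i j -> (i < n)%nat /\ (j < n)%nat) /\
  (exists L : list (nat * nat), NoDup L /\ length L = k /\
     forall p, In p L <-> S (fst p) (snd p)) /\
  (forall i j i' j', S i j -> (i' < n)%nat -> (j' < n)%nat -> ~ S i' j' ->
     A i' + B j' <= A i + B j).

Definition reports (A B : nat -> R) (S : nat -> nat -> Prop)
  (o : list (nat * nat * R)) : Prop :=
  NoDup (map fst o) /\
  (forall i j v, In (i, j, v) o -> S i j /\ v = A i + B j) /\
  (forall i j, S i j -> exists v, In (i, j, v) o).

(* Main.v *)
Require Import Defs.
From Stdlib Require Import Reals List Arith Lia Lra.
Import ListNotations.
Open Scope nat_scope.

(* With s = floor(sqrt k), the k largest sums can be chosen in the first s rows
   and the first s columns: m = 2 s sorted lists (column lists start at row s,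
   so that the lists are disjoint). They are selected greedily in blocks of
   w = 2^r elements, for decreasing r. Let K be the number of elements still to
   be selected. If K > m (w - 1), the list whose w-th remaining element is the
   largest gives away its next w elements: fewer than w elements of every other
   list precede that element, so it is among the K largest remaining ones.
   When K <= m (w - 1), w is halved; hence each of the O(log k) phases makes at
   most m selections, each O(log k) with a tournament tree over the lists. *)

(** What makes [s] rows and columns enough is [k < (s + 1)^2]: a cell with both indices at least [s]
    is no larger than any other cell of the leading box of side [s + 1], and these are already at
    least [k]. Ties are the delicate point, since blocks are committed before the outcome is known.
    A total order on the cells of the lists, refining the order of the values, fixes the final ends
    [f] of the lists in advance. The invariant is then only that the current ends stay at or below
    [f] and that the distances to [f] sum to K; once K is 0 the ends equal [f]. The block length
    starts at a power of two above [k], so that K <= m (w - 1) holds at the outset. Halving w = 2 u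
    turns this bound into K <= m (u - 1) + m u, which leaves at most m selections of u elements;
    after the phase with w = 1 it reads K <= 0. To keep machine code out of these arguments, the
    programs are written in a small structured language with unit costs. A compiled program spends
    at most its own length, a constant, in machine steps per unit. *)

(** * A structured language with a cost semantics *)

Inductive binop : Type := OAdd | OSub | OMul | ODiv.

Inductive nexp : Type :=
| V (r : nat)
| C (c : nat)
| Bin (op : binop) (e1 e2 : nexp)
| H (e : nexp).

Inductive test : Type :=
| TLt (e1 e2 : nexp)
| TSum (e1 e2 e3 e4 : nexp).

Inductive cmd : Type :=
| Skip
| Assign (r : nat) (e : nexp)
| Store (e1 e2 : nexp)
| Print (e1 e2 : nexp)
| Seq (c1 c2 : cmd)
| If (b : test) (c1 c2 : cmd)
| While (b : test) (c : cmd).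

Declare Scope cmd_scope.
Delimit Scope cmd_scope with cmd.
Bind Scope cmd_scope with cmd.
Declare Scope nexp_scope.
Delimit Scope nexp_scope with nexp.
Bind Scope nexp_scope with nexp.
Bind Scope nexp_scope with test.
Coercion C : nat >-> nexp.
Infix "+" := (Bin OAdd) : nexp_scope.
Infix "-" := (Bin OSub) : nexp_scope.
Infix "*" := (Bin OMul) : nexp_scope.
Infix "/" := (Bin ODiv) : nexp_scope.
Infix "<" := TLt : nexp_scope.
Notation "r <~ e" := (Assign r e%nexp) (at level 60) : cmd_scope.
Notation "'heap' e1 <~ e2" := (Store e1%nexp e2%nexp)
  (at level 60, e1 at level 9) : cmd_scope.
Notation "c1 ;; c2" := (Seq c1 c2)
  (at level 65, right associativity) : cmd_scope.

(* Scalars are kept as a list padded with zeros, so that symbolic execution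
   of a program on an explicit list of registers is mere computation. *)
Record mem : Type := Mem {
  sv : list nat;
  hp : nat -> nat;
  ou : list (nat * nat * R)
}.

Fixpoint setl (l : list nat) (r v : nat) : list nat :=
  match r, l with
  | 0, [] => [v]
  | 0, _ :: l' => v :: l'
  | S r', [] => 0 :: setl [] r' v
  | S r', x :: l' => x :: setl l' r' v
  end.

Definition op_fun (op : binop) : nat -> nat -> nat :=
  match op with
  | OAdd => Nat.add
  | OSub => Nat.sub
  | OMul => Nat.mul
  | ODiv => Nat.div
  end.

Fixpoint eval (l : list nat) (h : nat -> nat) (e : nexp) : nat :=
  match e with
  | V r => nth r l 0
  | C c => c
  | Bin op e1 e2 => op_fun op (eval l h e1) (eval l h e2)
  | H e1 => h (eval l h e1)
  end.

Section Semantics.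
Variables A B : nat -> R.

Definition holds (l : list nat) (h : nat -> nat) (b : test) : Prop :=
  match b with
  | TLt e1 e2 => eval l h e1 < eval l h e2
  | TSum e1 e2 e3 e4 =>
      (A (eval l h e1) + B (eval l h e2) < A (eval l h e3) + B (eval l h e4))%R
  end.

Lemma holds_dec l h b : holds l h b \/ ~ holds l h b.
Proof.
  destruct b; simpl.
  - lia.
  - destruct (Rlt_dec (A (eval l h e1) + B (eval l h e2))
                      (A (eval l h e3) + B (eval l h e4))); auto.
Qed.

Inductive exec : cmd -> mem -> nat -> mem -> Prop :=
| exec_skip s : exec Skip s 1 s
| exec_assign r e l h o :
    exec (Assign r e) (Mem l h o) 1 (Mem (setl l r (eval l h e)) h o)
| exec_store e1 e2 l h o :
    exec (Store e1 e2) (Mem l h o) 1 (Mem l (upd h (eval l h e1) (eval l h e2)) o)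
| exec_print e1 e2 l h o :
    exec (Print e1 e2) (Mem l h o) 1
      (Mem l h (o ++ [(eval l h e1, eval l h e2,
                       (A (eval l h e1) + B (eval l h e2))%R)]))
| exec_seq c1 c2 s1 s2 s3 t1 t2 :
    exec c1 s1 t1 s2 -> exec c2 s2 t2 s3 -> exec (Seq c1 c2) s1 (t1 + t2) s3
| exec_if_true b c1 c2 l h o s t :
    holds l h b -> exec c1 (Mem l h o) t s -> exec (If b c1 c2) (Mem l h o) (1 + t) s
| exec_if_false b c1 c2 l h o s t :
    ~ holds l h b -> exec c2 (Mem l h o) t s -> exec (If b c1 c2) (Mem l h o) (1 + t) s
| exec_while_true b c l h o s1 s2 t1 t2 :
    holds l h b -> exec c (Mem l h o) t1 s1 -> exec (While b c) s1 t2 s2 ->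
    exec (While b c) (Mem l h o) (1 + t1 + t2) s2
| exec_while_false b c l h o :
    ~ holds l h b -> exec (While b c) (Mem l h o) 1 (Mem l h o).

(** Total correctness in predicate-transformer form. The postcondition also receives the cost, so a
    sequence of commands is executed symbolically from the front while the cost accumulates as a
    sum. *)
Definition ok (c : cmd) (s : mem) (Q : mem -> nat -> Prop) : Prop :=
  exists t s', exec c s t s' /\ Q s' t.

Lemma ok_mono c s (Q Q' : mem -> nat -> Prop) :
  ok c s Q -> (forall s' t, Q s' t -> Q' s' t) -> ok c s Q'.
Proof. intros (t & s' & He & HQ) HQQ. exists t, s'. auto. Qed.

Lemma ok_skip s Q : Q s 1 -> ok Skip s Q.
Proof. intros. eexists _, _. split; [constructor|assumption]. Qed.

Lemma ok_assign r e l h o (Q : mem -> nat -> Prop) :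
  Q (Mem (setl l r (eval l h e)) h o) 1 -> ok (Assign r e) (Mem l h o) Q.
Proof. intros. eexists _, _. split; [constructor|assumption]. Qed.

Lemma ok_store e1 e2 l h o (Q : mem -> nat -> Prop) :
  Q (Mem l (upd h (eval l h e1) (eval l h e2)) o) 1 -> ok (Store e1 e2) (Mem l h o) Q.
Proof. intros. eexists _, _. split; [constructor|assumption]. Qed.

Lemma ok_print e1 e2 l h o (Q : mem -> nat -> Prop) :
  Q (Mem l h (o ++ [(eval l h e1, eval l h e2,
                       (A (eval l h e1) + B (eval l h e2))%R)])) 1 ->
  ok (Print e1 e2) (Mem l h o) Q.
Proof. intros. eexists _, _. split; [constructor|assumption]. Qed.

Lemma ok_seq c1 c2 s (Q : mem -> nat -> Prop) :
  ok c1 s (fun s1 t1 => ok c2 s1 (fun s2 t2 => Q s2 (t1 + t2))) ->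
  ok (Seq c1 c2) s Q.
Proof.
  intros (t1 & s1 & H1 & t2 & s2 & H2 & HQ).
  exists (t1 + t2), s2. split; [econstructor; eassumption|assumption].
Qed.

Lemma ok_if b c1 c2 l h o (Q : mem -> nat -> Prop) :
  (holds l h b -> ok c1 (Mem l h o) (fun s t => Q s (1 + t))) ->
  (~ holds l h b -> ok c2 (Mem l h o) (fun s t => Q s (1 + t))) ->
  ok (If b c1 c2) (Mem l h o) Q.
Proof.
  intros H1 H2. destruct (holds_dec l h b) as [Hb|Hb].
  - destruct (H1 Hb) as (t & s & He & HQ). exists (1 + t), s.
    split; [apply exec_if_true|]; assumption.
  - destruct (H2 Hb) as (t & s & He & HQ). exists (1 + t), s.
    split; [apply exec_if_false|]; assumption.
Qed.

(* [I s d]: the invariant at state [s] after [d] time units;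
   [mu] decreases along the iterations. *)
Lemma ok_while_spent b c (I : mem -> nat -> Prop) (mu : mem -> nat) :
  (forall l h o d, I (Mem l h o) d -> holds l h b ->
     ok c (Mem l h o) (fun s t => I s (d + 1 + t) /\ mu s < mu (Mem l h o))) ->
  forall s, I s 0 ->
  ok (While b c) s
    (fun s' t => exists d, t = d + 1 /\ I s' d /\ ~ holds (sv s') (hp s') b).
Proof.
  intros Hbody.
  (* Induction on a bound of the measure, generalized over the time [d] already spent, since the
     loop restarts with a nonzero [d]. *)
  enough (Hgen : forall n s d, mu s < n -> I s d ->
    ok (While b c) s (fun s' t => exists d', d + t = d' + 1 /\ I s' d'
                                 /\ ~ holds (sv s') (hp s') b)).
  { intros s Hs. exact (Hgen (S (mu s)) s 0 (Nat.lt_succ_diag_r _) Hs). }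
  induction n as [|n IH]; intros s d Hn Hs; [lia|].
  destruct s as [l h o].
  destruct (holds_dec l h b) as [Hb|Hb].
  - destruct (Hbody _ _ _ _ Hs Hb) as (t1 & s1 & He1 & Hs1 & Hmu).
    destruct (IH s1 _ ltac:(lia) Hs1) as (t2 & s2 & He2 & d' & Hd & H2).
    exists (1 + t1 + t2), s2. split; [eapply exec_while_true; eassumption|].
    exists d'. split; [lia|assumption].
  - exists 1, (Mem l h o). split; [apply exec_while_false; assumption|].
    exists d. simpl. auto.
Qed.

(* [I n s]: at most [n] iterations remain from [s]. *)
Lemma ok_while b c (I : nat -> mem -> Prop) (q : nat) :
  (forall n l h o, I n (Mem l h o) -> holds l h b ->
     exists n', n = S n' /\ ok c (Mem l h o) (fun s t => I n' s /\ t <= q)) ->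
  forall n s, I n s ->
  ok (While b c) s
    (fun s' t => (exists n', I n' s') /\ ~ holds (sv s') (hp s') b
                 /\ t <= (q + 1) * n + 1).
Proof.
  intros Hbody. induction n as [|n IH]; intros [l h o] Hs.
  - exists 1, (Mem l h o). split.
    + apply exec_while_false. intros Hb.
      destruct (Hbody _ _ _ _ Hs Hb) as (n' & Hn & _). discriminate.
    + split; [eauto|]. split; [|lia].
      intros Hb. destruct (Hbody _ _ _ _ Hs Hb) as (n' & Hn & _). discriminate.
  - destruct (holds_dec l h b) as [Hb|Hb].
    + destruct (Hbody _ _ _ _ Hs Hb) as (n' & [= <-] & t1 & s1 & He1 & Hs1 & Ht1).
      destruct (IH _ Hs1) as (t2 & s2 & He2 & Hs2 & Hb2 & Ht2).
      exists (1 + t1 + t2), s2. split; [eapply exec_while_true; eassumption|].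
      split; [assumption|]. split; [assumption|lia].
    + exists 1, (Mem l h o). split; [apply exec_while_false; assumption|].
      split; [eauto|]. split; [assumption|lia].
Qed.

End Semantics.

(** * Compilation *)

Definition op_instr (op : binop) : nat -> nat -> nat -> instr :=
  match op with
  | OAdd => NAdd
  | OSub => NSub
  | OMul => NMul
  | ODiv => NDiv
  end.

(* Registers below 32 hold the scalars, 32..63 the temporaries of expression
   evaluation, and cell [i] of the heap lives in register [64 + i]. *)
Fixpoint comp_exp (e : nexp) (d : nat) : list instr :=
  match e with
  | V r => [NConst d 0; NAdd d d r]
  | C c => [NConst d c]
  | Bin op e1 e2 => comp_exp e1 d ++ comp_exp e2 (S d) ++ [op_instr op d d (S d)]
  | H e1 => comp_exp e1 d ++ [NConst (S d) 64; NAdd d d (S d); NLoad d d]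
  end.

Definition comp_test (b : test) (tgt : nat) : list instr :=
  match b with
  | TLt e1 e2 => comp_exp e1 32 ++ comp_exp e2 33 ++ [JNLt 32 33 tgt]
  | TSum e1 e2 e3 e4 =>
      comp_exp e1 32 ++ [ReadA 0 32] ++ comp_exp e2 32 ++ [ReadB 1 32; RAdd 0 0 1] ++
      comp_exp e3 32 ++ [ReadA 1 32] ++ comp_exp e4 32 ++ [ReadB 2 32; RAdd 1 1 2] ++
      [JRLt 0 1 tgt]
  end.

Definition goto (tgt : nat) : list instr := [NConst 32 0; NConst 33 1; JNLt 32 33 tgt].

(** Code length does not depend on the position of the code. Having it separately lets [compile] fix
    a forward jump before the code that it skips. *)
Fixpoint clen (c : cmd) : nat :=
  match c with
  | Skip => 0
  | Assign r e => length (comp_exp e 32) + 2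
  | Store e1 e2 => length (comp_exp e1 32) + length (comp_exp e2 33) + 3
  | Print e1 e2 => length (comp_exp e1 32) + length (comp_exp e2 33) + 4
  | Seq c1 c2 => clen c1 + clen c2
  | If b c1 c2 => length (comp_test b 0) + clen c2 + 3 + clen c1
  | While b c => length (comp_test b 0) + 3 + clen c + 3
  end.

Fixpoint compile (c : cmd) (p : nat) : list instr :=
  match c with
  | Skip => []
  | Assign r e => comp_exp e 32 ++ [NConst r 0; NAdd r r 32]
  | Store e1 e2 =>
      comp_exp e1 32 ++ comp_exp e2 33 ++ [NConst 34 64; NAdd 32 32 34; NStore 32 33]
  | Print e1 e2 =>
      comp_exp e1 32 ++ comp_exp e2 33 ++
      [ReadA 0 32; ReadB 1 33; RAdd 0 0 1; Out 32 33 0]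
  | Seq c1 c2 => compile c1 p ++ compile c2 (p + clen c1)
  | If b c1 c2 =>
      let q := p + length (comp_test b 0) in
      let r := q + clen c2 + 3 in
      comp_test b r ++ compile c2 q ++ goto (r + clen c1) ++ compile c1 r
  | While b c =>
      let q := p + length (comp_test b 0) + 3 in
      comp_test b q ++ goto (q + clen c + 3) ++ compile c q ++ goto p
  end.

(** Leaves ask for [S d < 64], not [d < 64], because a heap access around a leaf puts the offset 64
    in the temporary [S d]. *)
Fixpoint wf_exp (e : nexp) (d : nat) : bool :=
  match e with
  | V r => Nat.ltb r 32 && Nat.ltb (S d) 64
  | C c => Nat.ltb (S d) 64
  | Bin _ e1 e2 => wf_exp e1 d && wf_exp e2 (S d)
  | H e1 => wf_exp e1 d
  end.

Definition wf_test (b : test) : bool :=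
  match b with
  | TLt e1 e2 => wf_exp e1 32 && wf_exp e2 33
  | TSum e1 e2 e3 e4 => wf_exp e1 32 && wf_exp e2 32 && wf_exp e3 32 && wf_exp e4 32
  end.

Fixpoint wf_cmd (c : cmd) : bool :=
  match c with
  | Skip => true
  | Assign r e => Nat.ltb r 32 && wf_exp e 32
  | Store e1 e2 | Print e1 e2 => wf_exp e1 32 && wf_exp e2 33
  | Seq c1 c2 => wf_cmd c1 && wf_cmd c2
  | If b c1 c2 => wf_test b && wf_cmd c1 && wf_cmd c2
  | While b c => wf_test b && wf_cmd c
  end.

Lemma length_comp_test b p q : length (comp_test b p) = length (comp_test b q).
Proof. destruct b; simpl; repeat (rewrite length_app; simpl); reflexivity. Qed.

Lemma length_compile c p : length (compile c p) = clen c.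
Proof.
  revert p. induction c; intros p; simpl; rewrite ?length_app; simpl;
    rewrite ?length_app; simpl; rewrite ?IHc, ?IHc1, ?IHc2;
    try rewrite (length_comp_test b _ 0); lia.
Qed.

(** * Simulation of the structured language by the machine *)

Definition code_at (P : program) (p : nat) (code : list instr) : Prop :=
  forall i x, nth_error code i = Some x -> nth_error P (p + i) = Some x.

Lemma code_at_app P p c1 c2 :
  code_at P p (c1 ++ c2) -> code_at P p c1 /\ code_at P (p + length c1) c2.
Proof.
  intros Hc. split; intros i x Hi.
  - apply Hc. rewrite nth_error_app1; [assumption|].
    apply nth_error_Some. congruence.
  - replace (p + length c1 + i) with (p + (length c1 + i)) by lia.
    apply Hc. rewrite nth_error_app2 by lia.
    replace (length c1 + i - length c1) with i by lia. assumption.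
Qed.

Lemma code_at_cons P p x c :
  code_at P p (x :: c) -> nth_error P p = Some x /\ code_at P (S p) c.
Proof.
  intros Hc. split.
  - replace p with (p + 0) by lia. apply Hc. reflexivity.
  - intros i y Hi. replace (S p + i) with (p + S i) by lia. apply Hc. exact Hi.
Qed.

(** Registers 32 to 63 and the real registers are left free, so compiled code may leave arbitrary
    values in them. *)
Definition rel (l : list nat) (h : nat -> nat) (N : nat -> nat) : Prop :=
  (forall x, x < 32 -> N x = nth x l 0) /\ (forall x, N (64 + x) = h x).

Lemma upd_same {X : Type} (f : nat -> X) a v : upd f a v a = v.
Proof. unfold upd. rewrite Nat.eqb_refl. reflexivity. Qed.

Lemma upd_other {X : Type} (f : nat -> X) a v b : b <> a -> upd f a v b = f b.
Proof. intros Hb. unfold upd. apply Nat.eqb_neq in Hb. rewrite Hb. reflexivity. Qed.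

Lemma nth_setl l r v x : nth x (setl l r v) 0 = if Nat.eqb x r then v else nth x l 0.
Proof.
  revert l x. induction r as [|r IH]; intros [|y l] [|x]; simpl; try reflexivity.
  - destruct x; reflexivity.
  - rewrite IH. destruct x; reflexivity.
  - apply IH.
Qed.

Lemma rel_temp l h N d v : 32 <= d < 64 -> rel l h N -> rel l h (upd N d v).
Proof.
  intros Hd [H1 H2]. split; intros x; [intros Hx|]; rewrite upd_other by lia; auto.
Qed.

Section Correctness.
Variables (P : program) (A B : nat -> R).

Definition reach (s : state) (t : nat) (s' : state) : Prop := run P A B t s = s'.

Lemma run_add t1 t2 s : run P A B (t1 + t2) s = run P A B t2 (run P A B t1 s).
Proof. revert s. induction t1 as [|t1 IH]; intros s; simpl; auto. Qed.

Lemma reach_trans s1 s2 s3 t1 t2 :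
  reach s1 t1 s2 -> reach s2 t2 s3 -> reach s1 (t1 + t2) s3.
Proof. unfold reach. intros H1 H2. rewrite run_add, H1. exact H2. Qed.

Lemma reach_refl p p' N Rg o : p = p' -> reach (mkState p N Rg o) 0 (mkState p' N Rg o).
Proof. intros ->. reflexivity. Qed.

Lemma reach_time s t t' s' : reach s t s' -> t = t' -> reach s t' s'.
Proof. intros Hr <-. exact Hr. Qed.

(** One machine step with the match on the instruction outermost: once the instruction is known, the
    next state appears by computation. *)
Lemma reach_cons i p N Rg o t s' : nth_error P p = Some i ->
  reach (match i with
  | Halt => mkState p N Rg o
  | NConst d c => mkState (S p) (upd N d c) Rg o
  | NAdd d a b => mkState (S p) (upd N d (N a + N b)) Rg o
  | NSub d a b => mkState (S p) (upd N d (N a - N b)) Rg o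
  | NMul d a b => mkState (S p) (upd N d (N a * N b)) Rg o
  | NDiv d a b => mkState (S p) (upd N d (Nat.div (N a) (N b))) Rg o
  | NLoad d a => mkState (S p) (upd N d (N (N a))) Rg o
  | NStore a s' => mkState (S p) (upd N (N a) (N s')) Rg o
  | RLoad d a => mkState (S p) N (upd Rg d (Rg (N a))) o
  | RStore a s' => mkState (S p) N (upd Rg (N a) (Rg s')) o
  | ReadA d i => mkState (S p) N (upd Rg d (A (N i))) o
  | ReadB d i => mkState (S p) N (upd Rg d (B (N i))) o
  | RAdd d a b => mkState (S p) N (upd Rg d (Rg a + Rg b)%R) o
  | RSub d a b => mkState (S p) N (upd Rg d (Rg a - Rg b)%R) o
  | JNLt a b t => mkState (if Nat.ltb (N a) (N b) then t else S p) N Rg o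
  | JRLt a b t => mkState (if Rlt_dec (Rg a) (Rg b) then t else S p) N Rg o
  | Out a b v => mkState (S p) N Rg (o ++ [(N a, N b, Rg v)])
  end) t s' -> reach (mkState p N Rg o) (S t) s'.
Proof.
  intros Hp Hr. unfold reach. cbn [run step]. rewrite Hp. destruct i; exact Hr.
Qed.

Ltac cat Hc :=
  let H' := fresh "Hi" in
  first [ apply code_at_app in Hc; destruct Hc as [H' Hc]
        | apply code_at_cons in Hc; destruct Hc as [H' Hc] ].

Ltac exec1 :=
  match goal with
  | Hi : nth_error P ?p = Some _ |- reach (mkState ?p _ _ _) _ _ =>
      eapply (reach_cons _ _ _ _ _ _ _ Hi); clear Hi; cbv beta iota
  end.

Ltac len :=
  repeat (rewrite length_app in *; cbn [length] in * );
  rewrite ?length_app; cbn [length]; lia.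

Ltac finish := apply reach_refl; len.

Ltac regs := rewrite ?upd_same, ?upd_other by lia.

Lemma wf_exp_depth e d : wf_exp e d = true -> S d < 64.
Proof.
  revert d. induction e; simpl; intros d; rewrite ?Bool.andb_true_iff, ?Nat.ltb_lt;
    firstorder.
Qed.

(** The last clause protects the temporaries below [d]: the value of a left operand must survive the
    evaluation of the right one. *)
Lemma comp_exp_ok e : forall d p l h N Rg o,
  wf_exp e d = true -> 32 <= d -> code_at P p (comp_exp e d) -> rel l h N ->
  exists N', reach (mkState p N Rg o) (length (comp_exp e d))
               (mkState (p + length (comp_exp e d)) N' Rg o)
    /\ rel l h N' /\ N' d = eval l h e /\ (forall x, 32 <= x < d -> N' x = N x).
Proof.
  induction e; intros d p l h N Rg o Hw Hd Hc Hr; pose proof (wf_exp_depth _ _ Hw) as Hd'.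
  - simpl in *. rewrite Bool.andb_true_iff, !Nat.ltb_lt in Hw.
    cat Hc; cat Hc.
    eexists. split; [exec1; exec1; finish|].
    split; [repeat apply rel_temp; auto; lia|].
    split; [regs; apply Hr; lia|].
    intros x Hx. regs. reflexivity.
  - simpl in *. cat Hc.
    eexists. split; [exec1; finish|].
    split; [repeat apply rel_temp; auto; lia|].
    split; [regs; reflexivity|].
    intros x Hx. regs. reflexivity.
  - simpl in *. rewrite Bool.andb_true_iff in Hw. destruct Hw as [Hw1 Hw2].
    pose proof (wf_exp_depth _ _ Hw2) as Hd''.
    cat Hc. cat Hc. cat Hc.
    destruct (IHe1 _ _ _ _ _ Rg o Hw1 Hd Hi Hr) as (N1 & R1 & Hr1 & Hv1 & Hf1).
    destruct (IHe2 _ _ _ _ _ Rg o Hw2 ltac:(lia) Hi0 Hr1) as (N2 & R2 & Hr2 & Hv2 & Hf2).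
    exists (upd N2 d (op_fun op (N2 d) (N2 (S d)))). split.
    { eapply reach_time; [eapply reach_trans; [exact R1|]; eapply reach_trans; [exact R2|]|].
      - eapply (reach_cons _ _ _ _ _ _ _ Hi1). destruct op; finish.
      - len. }
    split; [repeat apply rel_temp; auto; lia|].
    split; [regs; rewrite Hv2, Hf2 by lia; congruence|].
    intros x Hx. regs. rewrite Hf2, Hf1 by lia. reflexivity.
  - simpl in *. cat Hc. cat Hc. cat Hc. cat Hc.
    destruct (IHe _ _ _ _ _ Rg o Hw Hd Hi Hr) as (N1 & R1 & Hr1 & Hv1 & Hf1).
    eexists. split.
    { eapply reach_time; [eapply reach_trans; [exact R1|]|].
      - exec1. exec1. exec1. finish.
      - len. }
    split; [repeat apply rel_temp; auto; lia|].
    split.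
    + regs. rewrite Hv1. rewrite Nat.add_comm. regs. apply Hr1.
    + intros x Hx. regs. auto.
Qed.

Lemma comp_test_ok b p tgt l h N Rg o :
  wf_test b = true -> code_at P p (comp_test b tgt) -> rel l h N ->
  exists N' Rg' p', reach (mkState p N Rg o) (length (comp_test b 0)) (mkState p' N' Rg' o)
    /\ rel l h N'
    /\ (holds A B l h b -> p' = tgt)
    /\ (~ holds A B l h b -> p' = p + length (comp_test b 0)).
Proof.
  rewrite (length_comp_test b 0 tgt).
  intros Hw Hc Hr. destruct b; simpl in *; rewrite ?Bool.andb_true_iff in Hw.
  - destruct Hw as [Hw1 Hw2]. cat Hc. cat Hc. cat Hc.
    destruct (comp_exp_ok _ _ _ _ _ _ Rg o Hw1 ltac:(lia) Hi Hr) as (N1 & R1 & Hr1 & Hv1 & Hf1).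
    destruct (comp_exp_ok _ _ _ _ _ _ Rg o Hw2 ltac:(lia) Hi0 Hr1) as (N2 & R2 & Hr2 & Hv2 & Hf2).
    eexists N2, Rg, _. split.
    { eapply reach_time; [eapply reach_trans; [exact R1|]; eapply reach_trans; [exact R2|]|].
      - exec1. apply reach_refl. reflexivity.
      - len. }
    rewrite Hv2, (Hf2 32), Hv1 by lia.
    split; [assumption|]. split; intros Hb.
    + apply Nat.ltb_lt in Hb. rewrite Hb. reflexivity.
    + destruct (Nat.ltb_spec (eval l h e1) (eval l h e2)); [tauto|]. len.
  - destruct Hw as [[[Hw1 Hw2] Hw3] Hw4].
    do 11 cat Hc.
    destruct (comp_exp_ok _ _ _ _ _ _ Rg o Hw1 ltac:(lia) Hi Hr) as (N1 & R1 & Hr1 & Hv1 & _).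
    edestruct (comp_exp_ok e2) as (N2 & R2 & Hr2 & Hv2 & _);
      [exact Hw2| |exact Hi1|exact Hr1|]; [lia|].
    edestruct (comp_exp_ok e3) as (N3 & R3 & Hr3 & Hv3 & _);
      [exact Hw3| |exact Hi4|exact Hr2|]; [lia|].
    edestruct (comp_exp_ok e4) as (N4 & R4 & Hr4 & Hv4 & _);
      [exact Hw4| |exact Hi6|exact Hr3|]; [lia|].
    eexists N4, _, _. split.
    { eapply reach_time; [eapply reach_trans; [exact R1|]; exec1;
        eapply reach_trans; [exact R2|]; exec1; exec1;
        eapply reach_trans; [exact R3|]; exec1;
        eapply reach_trans; [exact R4|]; exec1; exec1; exec1; apply reach_refl; reflexivity|].
      len. }
    split; [assumption|]. regs. rewrite Hv1, Hv2, Hv3, Hv4.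
    destruct Rlt_dec as [Hlt|Hlt]; split; intros Hb; try tauto. len.
Qed.

Lemma goto_ok tgt p l h N Rg o :
  code_at P p (goto tgt) -> rel l h N ->
  exists N', reach (mkState p N Rg o) 3 (mkState tgt N' Rg o) /\ rel l h N'.
Proof.
  intros Hc Hr. unfold goto in Hc. do 3 cat Hc.
  eexists. split; [exec1; exec1; exec1; apply reach_refl; regs; reflexivity|].
  repeat apply rel_temp; auto; lia.
Qed.

Lemma rel_store l h N i v : rel l h N -> rel l (upd h i v) (upd N (i + 64) v).
Proof.
  intros [H1 H2]. split; intros x.
  - intros Hx. regs. auto.
  - unfold upd. destruct (Nat.eqb_spec x i); destruct (Nat.eqb_spec (64 + x) (i + 64));
      auto; lia.
Qed.

(** Every rule of [exec] that runs instructions of its own charges one unit and runs at most the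
    whole code of its command once, apart from the subcommands. The bound [K] is arbitrary above
    [clen c] so that the induction passes one [K] on to all subcommands. *)
Theorem compile_ok c s t s' : exec A B c s t s' -> wf_cmd c = true ->
  forall p N Rg K, code_at P p (compile c p) -> rel (sv s) (hp s) N -> clen c <= K ->
  exists T N' Rg', T <= K * t
    /\ reach (mkState p N Rg (ou s)) T (mkState (p + clen c) N' Rg' (ou s'))
    /\ rel (sv s') (hp s') N'.
Proof.
  induction 1; intros Hw p N Rg K Hc Hr HK; cbn [wf_cmd compile clen sv hp ou] in *;
    rewrite ?Bool.andb_true_iff in Hw.
  - exists 0, N, Rg. split; [lia|]. split; [finish|assumption].
  - destruct Hw as [Hw1 Hw2]. apply Nat.ltb_lt in Hw1. do 3 cat Hc.
    destruct (comp_exp_ok _ _ _ _ _ _ Rg o Hw2 ltac:(lia) Hi Hr) as (N1 & R1 & Hr1 & Hv1 & _).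
    eexists _, _, Rg. split; [|split].
    2:{ eapply reach_trans; [exact R1|]. exec1. exec1. finish. }
    + lia.
    + regs. rewrite Hv1. cbn [Nat.add].
      destruct Hr1 as [Ha Hb]. split; intros x.
      * intros Hx. rewrite nth_setl. unfold upd. destruct (Nat.eqb x r); auto.
      * regs. auto.
  - destruct Hw as [Hw1 Hw2]. do 5 cat Hc.
    destruct (comp_exp_ok _ _ _ _ _ _ Rg o Hw1 ltac:(lia) Hi Hr) as (N1 & R1 & Hr1 & Hv1 & _).
    destruct (comp_exp_ok _ _ _ _ _ _ Rg o Hw2 ltac:(lia) Hi0 Hr1) as (N2 & R2 & Hr2 & Hv2 & Hf2).
    eexists _, _, Rg. split; [|split].
    2:{ eapply reach_trans; [exact R1|]. eapply reach_trans; [exact R2|].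
        exec1. exec1. exec1. finish. }
    + lia.
    + regs. rewrite Hv2, Hf2, Hv1 by lia. apply rel_store.
      repeat apply rel_temp; auto; lia.
  - destruct Hw as [Hw1 Hw2]. do 6 cat Hc.
    destruct (comp_exp_ok _ _ _ _ _ _ Rg o Hw1 ltac:(lia) Hi Hr) as (N1 & R1 & Hr1 & Hv1 & _).
    destruct (comp_exp_ok _ _ _ _ _ _ Rg o Hw2 ltac:(lia) Hi0 Hr1) as (N2 & R2 & Hr2 & Hv2 & Hf2).
    eexists _, N2, _. split; [|split; [|assumption]].
    2:{ eapply reach_trans; [exact R1|]. eapply reach_trans; [exact R2|].
        exec1. exec1. exec1. exec1. regs. rewrite Hv2, Hf2, Hv1 by lia. finish. }
    lia.
  - destruct Hw as [Hw1 Hw2]. cat Hc. rewrite length_compile in Hc.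
    destruct (IHexec1 Hw1 _ _ Rg K Hi Hr ltac:(lia)) as (T1 & N1 & Rg1 & HT1 & R1 & Hr1).
    destruct (IHexec2 Hw2 _ _ Rg1 K Hc Hr1 ltac:(lia)) as (T2 & N2 & Rg2 & HT2 & R2 & Hr2).
    exists (T1 + T2), N2, Rg2. split; [lia|]. split; [|assumption].
    rewrite Nat.add_assoc. eapply reach_trans; eassumption.
  - destruct Hw as [[Hwb Hw1] Hw2]. do 3 cat Hc.
    rewrite (length_comp_test b _ 0), length_compile in *.
    destruct (comp_test_ok _ _ _ _ _ _ Rg o Hwb Hi Hr) as (N1 & Rg1 & p1 & R1 & Hr1 & Hp & _).
    rewrite (Hp H0) in R1.
    cbn [goto length] in Hc.
    destruct (IHexec Hw1 _ N1 Rg1 K Hc Hr1 ltac:(lia)) as (T2 & N2 & Rg2 & HT2 & R2 & Hr2).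
    eexists _, N2, Rg2. split; [|split; [|exact Hr2]].
    2:{ eapply reach_trans; [exact R1|].
        replace (p + (length (comp_test b 0) + clen c2 + 3 + clen c1))
          with (p + length (comp_test b 0) + clen c2 + 3 + clen c1) by lia. exact R2. }
    nia.
  - destruct Hw as [[Hwb Hw1] Hw2]. do 3 cat Hc.
    rewrite (length_comp_test b _ 0), length_compile in *.
    destruct (comp_test_ok _ _ _ _ _ _ Rg o Hwb Hi Hr) as (N1 & Rg1 & p1 & R1 & Hr1 & _ & Hp).
    rewrite (Hp H0) in R1.
    destruct (IHexec Hw2 _ N1 Rg1 K Hi0 Hr1 ltac:(lia)) as (T2 & N2 & Rg2 & HT2 & R2 & Hr2).
    destruct (goto_ok _ _ _ _ _ Rg2 (ou s) Hi1 Hr2) as (N3 & R3 & Hr3).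
    eexists _, N3, Rg2. split; [|split; [|exact Hr3]].
    2:{ eapply reach_trans; [exact R1|]. eapply reach_trans; [exact R2|].
        replace (p + (length (comp_test b 0) + clen c2 + 3 + clen c1))
          with (p + length (comp_test b 0) + clen c2 + 3 + clen c1) by lia. exact R3. }
    nia.
  - assert (Hw0 := Hw). destruct Hw as [Hwb Hwc]. assert (Hc0 := Hc). do 3 cat Hc.
    rewrite (length_comp_test b _ 0), length_compile in *.
    destruct (comp_test_ok _ _ _ _ _ _ Rg o Hwb Hi Hr) as (N1 & Rg1 & p1 & R1 & Hr1 & Hp & _).
    rewrite (Hp H0) in R1. cbn [goto length] in *.
    destruct (IHexec1 Hwc _ N1 Rg1 K Hi1 Hr1 ltac:(lia)) as (T2 & N2 & Rg2 & HT2 & R2 & Hr2).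
    destruct (goto_ok _ _ _ _ _ Rg2 (ou s1) Hc Hr2) as (N3 & R3 & Hr3).
    destruct (IHexec2 ltac:(rewrite !Bool.andb_true_iff; tauto) p N3 Rg2 K Hc0 Hr3 HK)
      as (T4 & N4 & Rg4 & HT4 & R4 & Hr4).
    eexists _, N4, Rg4. split; [|split; [|exact Hr4]].
    2:{ eapply reach_trans; [exact R1|]. eapply reach_trans; [exact R2|].
        eapply reach_trans; [exact R3|]. exact R4. }
    nia.
  - destruct Hw as [Hwb Hwc]. do 3 cat Hc.
    rewrite (length_comp_test b _ 0), length_compile in *.
    destruct (comp_test_ok _ _ _ _ _ _ Rg o Hwb Hi Hr) as (N1 & Rg1 & p1 & R1 & Hr1 & _ & Hp).
    rewrite (Hp H0) in R1.
    destruct (goto_ok _ _ _ _ _ Rg1 o Hi0 Hr1) as (N3 & R3 & Hr3).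
    eexists _, N3, Rg1. split; [|split; [|exact Hr3]].
    2:{ eapply reach_trans; [exact R1|].
        replace (p + (length (comp_test b 0) + 3 + clen c + 3))
          with (p + length (comp_test b 0) + 3 + clen c + 3) by lia. exact R3. }
    lia.
Qed.

End Correctness.

(** * Selection in sorted lists *)

Fixpoint sumf (f : nat -> nat) (m : nat) : nat :=
  match m with
  | 0 => 0
  | S m' => sumf f m' + f m'
  end.

Lemma sumf_le f g m : (forall t, t < m -> f t <= g t) -> sumf f m <= sumf g m.
Proof.
  induction m as [|m IH]; simpl; intros Hfg; [lia|].
  specialize (IH ltac:(auto)). specialize (Hfg m). lia.
Qed.

Lemma sumf_ext f g m : (forall t, t < m -> f t = g t) -> sumf f m = sumf g m.
Proof.
  intros Hfg. apply Nat.le_antisymm; apply sumf_le; intros t Ht; rewrite Hfg; auto.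
Qed.

Lemma sumf_const c m : sumf (fun _ => c) m = m * c.
Proof. induction m; simpl; lia. Qed.

(** Turns a count into pointwise information: knowing only the total, it pins down all list ends at
    once. *)
Lemma sumf_le_eq f g m : (forall t, t < m -> f t <= g t) -> sumf g m <= sumf f m ->
  forall t, t < m -> f t = g t.
Proof.
  induction m as [|m IH]; simpl; intros Hfg Hs t Ht; [lia|].
  pose proof (sumf_le f g m ltac:(auto)). pose proof (Hfg m ltac:(lia)).
  destruct (Nat.eq_dec t m) as [->|Hne]; [lia|]. apply IH; auto; lia.
Qed.

Lemma sumf_change f g m t a : t < m -> (forall u, u < m -> u <> t -> f u = g u) ->
  f t = g t + a -> sumf f m = sumf g m + a.
Proof.
  induction m as [|m IH]; simpl; intros Ht Hfg Ha; [lia|].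
  destruct (Nat.eq_dec t m) as [->|Hne].
  - rewrite (sumf_ext f g m) by (intros; apply Hfg; lia). lia.
  - rewrite IH, (Hfg m) by (auto; lia). lia.
Qed.

Lemma sumf_add f a b : sumf f (a + b) = sumf f a + sumf (fun t => f (a + t)) b.
Proof.
  induction b as [|b IH]; simpl; [rewrite Nat.add_0_r; lia|].
  rewrite Nat.add_succ_r. simpl. lia.
Qed.

(** * The order on the cells and the prefixes that it determines *)

Section Lists.
Variables (n s : nat) (A B : nat -> R).

(* List [t < s] is row [t]; list [s + j] is column [j] from row [s] on.
   Position [x] of a list is the column (resp. row) index, so lists end at [n]. *)
Definition start (t : nat) : nat := if t <? s then 0 else s.

Definition cell (t x : nat) : nat * nat := if t <? s then (t, x) else (x, t - s).

Definition val (t x : nat) : R := (A (fst (cell t x)) + B (snd (cell t x)))%R.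

Lemma val_row t x : t < s -> val t x = (A t + B x)%R.
Proof. intros Ht. apply Nat.ltb_lt in Ht. unfold val, cell. rewrite Ht. reflexivity. Qed.

Lemma val_col j x : val (s + j) x = (A x + B j)%R.
Proof.
  unfold val, cell. rewrite (proj2 (Nat.ltb_ge (s + j) s)) by lia. simpl.
  replace (s + j - s) with j by lia. reflexivity.
Qed.

(* Breaking ties by the list index is compatible with dominance of cells. *)
Definition before (t x t' x' : nat) : Prop :=
  (val t' x' < val t x)%R \/ (val t x = val t' x' /\ (t < t' \/ (t = t' /\ x < x'))).

Lemma before_trans t x t' x' t'' x'' :
  before t x t' x' -> before t' x' t'' x'' -> before t x t'' x''.
Proof.
  unfold before. intros [H1|[H1 H1']] [H2|[H2 H2']]; try (left; lra).
  right. split; [lra|lia].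
Qed.

Lemma before_irrefl t x : ~ before t x t x.
Proof. intros [Hlt|[_ Hlt]]; [lra|lia]. Qed.

Lemma before_total t x t' x' : t <> t' -> before t x t' x' \/ before t' x' t x.
Proof.
  intros Hne. unfold before.
  destruct (Rtotal_order (val t x) (val t' x')) as [Hlt|[Heq|Hgt]]; [auto| |auto].
  destruct (Nat.lt_total t t') as [Hl|[Hl|Hl]]; [|lia|]; [left|right]; right; auto.
Qed.

(* [profile f q]: the prefixes of the lists up to [f] consist of the first
   [q] cells. *)
Definition profile (f : nat -> nat) (q : nat) : Prop :=
  (forall t, t < 2 * s -> start t <= f t <= n) /\
  sumf (fun t => f t - start t) (2 * s) = q /\
  (forall t t' x x', t < 2 * s -> t' < 2 * s -> x < f t -> f t' <= x' < n ->
     start t <= x -> before t x t' x').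

(** Supplies the next cell of a merge: the head that precedes all other heads, unless all lists are
    exhausted. *)
Lemma exists_first (f : nat -> nat) m :
  (forall t, t < m -> n <= f t) \/
  exists t, t < m /\ f t < n /\
    forall t', t' < m -> f t' < n -> t' <> t -> before t (f t) t' (f t').
Proof.
  induction m as [|m IH]; [left; lia|].
  destruct (le_lt_dec n (f m)) as [Hm|Hm].
  - destruct IH as [IH|(t & Ht & Hf & IH)]; [left|right].
    + intros t Ht. destruct (Nat.eq_dec t m) as [->|]; [assumption|apply IH; lia].
    + exists t. repeat split; [lia|assumption|].
      intros t' Ht' Hf' Hne. apply IH; auto.
      destruct (Nat.eq_dec t' m) as [->|]; lia.
  - right. destruct IH as [IH|(t & Ht & Hf & IH)].
    + exists m. repeat split; [lia|assumption|].
      intros t' Ht' Hf' Hne. specialize (IH t'). lia.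
    + destruct (before_total t (f t) m (f m) ltac:(lia)) as [Hb|Hb].
      * exists t. repeat split; [lia|assumption|].
        intros t' Ht' Hf' Hne. destruct (Nat.eq_dec t' m) as [->|]; [assumption|].
        apply IH; auto; lia.
      * exists m. repeat split; [lia|assumption|].
        intros t' Ht' Hf' Hne. destruct (Nat.eq_dec t' t) as [->|]; [assumption|].
        eapply before_trans; [exact Hb|]. apply IH; auto; lia.
Qed.

(** The number of cells of the L-shaped region covered by the lists, hence the largest size that a
    profile can have. *)
Lemma sumf_start_total :
  sumf (fun t => n - start t) (2 * s) = s * n + s * (n - s).
Proof.
  replace (2 * s) with (s + s) by lia. rewrite sumf_add. f_equal.
  - rewrite (sumf_ext _ (fun _ => n)); [apply sumf_const|].
    intros t Ht. unfold start. apply Nat.ltb_lt in Ht. rewrite Ht. lia.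
  - rewrite (sumf_ext _ (fun _ => n - s)); [apply sumf_const|].
    intros t Ht. unfold start. replace (s + t <? s) with false; [reflexivity|].
    symmetry. apply Nat.ltb_ge. lia.
Qed.

(* The candidate of a list is the last cell of its next block of [w] cells;
   an exhausted list counts as having the worst candidate. *)
Definition cand (w : nat) (lo : nat -> nat) (t : nat) : nat := lo t + w - 1.

Definition noworse (w : nat) (lo : nat -> nat) (t t' : nat) : Prop :=
  cand w lo t' < n ->
  cand w lo t < n /\ (t = t' \/ before t (cand w lo t) t' (cand w lo t')).

Lemma noworse_refl w lo t : noworse w lo t t.
Proof. unfold noworse. auto. Qed.

Lemma noworse_trans w lo t t' t'' :
  noworse w lo t t' -> noworse w lo t' t'' -> noworse w lo t t''.
Proof.
  unfold noworse. intros H1 H2 Hx. destruct (H2 Hx) as [Hx' H2'].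
  destruct (H1 Hx') as [Hx'' H1']. split; [assumption|].
  destruct H1' as [->|H1']; [assumption|].
  destruct H2' as [<-|H2']; [auto|]. right. eapply before_trans; eassumption.
Qed.

Definition selected (f : nat -> nat) (i j : nat) : Prop :=
  (i < s /\ j < f i) \/ (j < s /\ s <= i < f (s + j)).

Lemma selected_cell f i j :
  selected f i j <-> exists t x, t < 2 * s /\ start t <= x < f t /\ cell t x = (i, j).
Proof.
  unfold selected, start, cell. split.
  - intros [[Hi Hj]|[Hj Hi]].
    + exists i, j. rewrite (proj2 (Nat.ltb_lt i s)) by assumption. repeat split; lia.
    + exists (s + j), i. rewrite (proj2 (Nat.ltb_ge (s + j) s)) by lia.
      replace (s + j - s) with j by lia. repeat split; lia.
  - intros (t & x & Ht & Hx & Hc). destruct (Nat.ltb_spec t s); injection Hc as <- <-.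
    + left. lia.
    + right. replace (s + (t - s)) with t by lia. lia.
Qed.

(** This enumeration serves twice: its length gives the cardinality required by [is_topk], and the
    report program prints exactly this list, in this order. *)
Definition prefix_cells (f : nat -> nat) (m : nat) : list (nat * nat) :=
  flat_map (fun t => map (cell t) (seq (start t) (f t - start t))) (seq 0 m).

Lemma in_prefix_cells f m p :
  In p (prefix_cells f m) <-> exists t x, t < m /\ start t <= x < f t /\ cell t x = p.
Proof.
  unfold prefix_cells. rewrite in_flat_map. split.
  - intros (t & Ht & Hp). apply in_seq in Ht. apply in_map_iff in Hp.
    destruct Hp as (x & Hx & Hin). apply in_seq in Hin. exists t, x.
    repeat split; auto; lia.
  - intros (t & x & Ht & Hx & Hc). exists t. split; [apply in_seq; lia|].
    apply in_map_iff. exists x. split; [assumption|]. apply in_seq. lia.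
Qed.

Lemma length_prefix_cells f m :
  length (prefix_cells f m) = sumf (fun t => f t - start t) m.
Proof.
  unfold prefix_cells. induction m as [|m IH]; [reflexivity|].
  rewrite seq_S, flat_map_app, length_app, IH. simpl.
  rewrite app_nil_r, length_map, length_seq. reflexivity.
Qed.

(** A row cell and a column cell differ because row lists have first index below [s], while column
    lists begin at row [s]. *)
Lemma cell_inj t x t' x' : start t <= x -> start t' <= x' ->
  cell t x = cell t' x' -> t = t' /\ x = x'.
Proof.
  unfold start, cell.
  destruct (Nat.ltb_spec t s), (Nat.ltb_spec t' s); intros ? ? [= ? ?]; lia.
Qed.

Lemma NoDup_prefix_cells f m : NoDup (prefix_cells f m).
Proof.
  unfold prefix_cells. induction m as [|m IH]; [constructor|].
  rewrite seq_S, flat_map_app. apply NoDup_app; [assumption| |].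
  - simpl. rewrite app_nil_r. apply NoDup_map_NoDup_ForallPairs; [|apply seq_NoDup].
    intros x x' Hx Hx' Hc. apply in_seq in Hx, Hx'.
    eapply (cell_inj m x m x'); [lia|lia|assumption].
  - intros p Hp Hp'. apply in_prefix_cells in Hp. destruct Hp as (t & x & Ht & Hx & Hc).
    simpl in Hp'. rewrite app_nil_r in Hp'. apply in_map_iff in Hp'.
    destruct Hp' as (x' & Hc' & Hin). apply in_seq in Hin.
    destruct (cell_inj t x m x') as [Heq _]; [lia|lia|congruence|lia].
Qed.

Hypothesis sortA : sorted_noninc n A.
Hypothesis sortB : sorted_noninc n B.
Hypothesis s_pos : 1 <= s.
Hypothesis s_le_n : s <= n.

Lemma before_same t x x' : t < 2 * s -> x < x' < n -> before t x t x'.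
Proof.
  intros Ht Hx.
  assert (Hle : (val t x' <= val t x)%R).
  { unfold val, cell. destruct (Nat.ltb_spec t s); simpl.
    - apply Rplus_le_compat_l, sortB. lia.
    - apply Rplus_le_compat_r, sortA. lia. }
  unfold before. destruct Hle; [left; lra|right]. split; [congruence|lia].
Qed.

(** Merging the lists one cell at a time: the first head precedes all other heads, and each of these
    precedes the rest of its list. *)
Lemma exists_profile q : q <= s * n + s * (n - s) -> exists f, profile f q.
Proof.
  assert (Hst : forall t, start t <= n) by (intros t; unfold start; destruct (t <? s); lia).
  induction q as [|q IH]; intros Hq.
  - exists start. split; [auto|]. split.
    + rewrite (sumf_ext _ (fun _ => 0)) by (intros; lia). rewrite sumf_const. lia.
    + intros. lia.
  - destruct (IH ltac:(lia)) as (f & Hf & Hs & Hb). clear IH.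
    destruct (exists_first f (2 * s)) as [Hall|(t & Ht & Hft & Hmin)].
    { rewrite <- sumf_start_total in Hq.
      rewrite (sumf_ext _ (fun t => f t - start t)) in Hq; [lia|].
      intros t Ht. specialize (Hf t Ht). specialize (Hall t Ht). lia. }
    exists (upd f t (S (f t))). split; [|split].
    + intros u Hu. unfold upd. destruct (Nat.eqb_spec u t) as [->|];
        specialize (Hf _ Hu); lia.
    + rewrite (sumf_change _ (fun t => f t - start t) _ t 1 Ht); [lia| |].
      * intros u Hu Hne. rewrite upd_other by assumption. reflexivity.
      * rewrite upd_same. specialize (Hf _ Ht). lia.
    + intros u u' x x' Hu Hu' Hx Hx' Hsx.
      assert (Hx2 : f u' <= x' < n).
      { unfold upd in Hx'. destruct (Nat.eqb_spec u' t) as [->|]; lia. }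
      (* Cells selected earlier are covered by [Hb]; the only new one is the head [f t]. *)
      destruct (le_lt_dec (f u) x) as [Hge|Hlt]; [|apply Hb; auto].
      unfold upd in Hx. destruct (Nat.eqb_spec u t) as [->|]; [|lia].
      replace x with (f t) by lia.
      destruct (Nat.eq_dec u' t) as [->|Hne].
      * rewrite upd_same in Hx'. apply before_same; lia.
      * destruct (Nat.eq_dec x' (f u')) as [->|]; [apply Hmin; auto; lia|].
        eapply before_trans; [apply (Hmin u'); auto; lia|]. apply before_same; lia.
Qed.

(* Otherwise every list has fewer than [w] cells left below [f]. *)
Lemma block_accept f q lo w t : profile f q -> 1 <= w ->
  (forall u, u < 2 * s -> start u <= lo u <= f u) ->
  2 * s * (w - 1) < sumf (fun u => f u - lo u) (2 * s) ->
  t < 2 * s -> (forall u, u < 2 * s -> noworse w lo t u) ->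
  lo t + w <= f t.
Proof.
  intros (Hf & _ & Hb) Hw Hlo Hsum Ht Hbest.
  destruct (le_lt_dec (lo t + w) (f t)) as [|Hlt]; [assumption|exfalso].
  apply (Nat.lt_irrefl (2 * s * (w - 1))).
  eapply Nat.lt_le_trans; [exact Hsum|].
  rewrite <- (sumf_const (w - 1) (2 * s)). apply sumf_le. intros u Hu.
  destruct (le_lt_dec (f u - lo u) (w - 1)) as [|Hgt]; [assumption|exfalso].
  pose proof (Hf u Hu). pose proof (Hlo u Hu).
  (* If list [u] had at least [w] cells left, its candidate would lie inside the profile and that of
     [t] outside, so [u] would win against [t]. *)
  assert (Hcu : cand w lo u < f u) by (unfold cand; lia).
  destruct (Hbest u Hu ltac:(lia)) as [Hct Hor].
  assert (Hct' : f t <= cand w lo t) by (unfold cand; lia).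
  assert (Hbe : before u (cand w lo u) t (cand w lo t)).
  { apply Hb; auto. unfold cand. lia. }
  destruct Hor as [->|Hor]; [lia|].
  apply (before_irrefl t (cand w lo t)). eapply before_trans; eassumption.
Qed.

(** If row [S t] went further, its cell in column [f t] would precede the cell above it. By
    sortedness the two can at best tie, and ties favour the smaller list index. *)
Lemma profile_rows f q t : profile f q -> S t < s -> f (S t) <= f t.
Proof.
  intros (Hf & _ & Hb) Ht.
  destruct (le_lt_dec (f (S t)) (f t)) as [|Hlt]; [assumption|exfalso].
  pose proof (Hf (S t) ltac:(lia)).
  assert (Hs : start (S t) = 0) by (unfold start; apply Nat.ltb_lt in Ht; rewrite Ht; reflexivity).
  specialize (Hb (S t) t (f t) (f t) ltac:(lia) ltac:(lia) ltac:(lia) ltac:(lia) ltac:(lia)).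
  unfold before, val, cell in Hb.
  rewrite (proj2 (Nat.ltb_lt t s)), (proj2 (Nat.ltb_lt (S t) s)) in Hb by lia.
  simpl in Hb. pose proof (sortA t (S t) ltac:(lia)).
  destruct Hb as [Hb|Hb]; [lra|lia].
Qed.

Lemma profile_cols f q t : profile f q -> S t < s -> f (s + S t) <= f (s + t).
Proof.
  intros (Hf & _ & Hb) Ht.
  destruct (le_lt_dec (f (s + S t)) (f (s + t))) as [|Hlt]; [assumption|exfalso].
  pose proof (Hf (s + S t) ltac:(lia)). pose proof (Hf (s + t) ltac:(lia)) as Hft.
  assert (Hs : forall u, start (s + u) = s).
  { intros u. unfold start. rewrite (proj2 (Nat.ltb_ge (s + u) s)) by lia. reflexivity. }
  rewrite Hs in Hft.
  specialize (Hb (s + S t) (s + t) (f (s + t)) (f (s + t))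
    ltac:(lia) ltac:(lia) ltac:(lia) ltac:(lia) ltac:(rewrite Hs; lia)).
  unfold before, val, cell in Hb.
  rewrite !(proj2 (Nat.ltb_ge _ s)) in Hb by lia.
  simpl in Hb. pose proof (sortB t (S t) ltac:(lia)).
  replace (s + S t - s) with (S t) in Hb by lia. replace (s + t - s) with t in Hb by lia.
  destruct Hb as [Hb|Hb]; [lra|lia].
Qed.

(* A cell with both indices at least [s] is dominated by the [s + 1] by
   [s + 1] corner box; either a cell of the box in one of the lists is not
   selected, or the selected cells are exactly the other cells of the box. *)
Lemma profile_topk f k : profile f k -> k <= s * s + 2 * s ->
  is_topk n k A B (selected f).
Proof.
  intros Hp Hk. assert (Hp' := Hp). destruct Hp as (Hf & Hs & Hb).
  (* An unselected cell in the first [s] rows or columns belongs to a list, so the profile itself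
     compares it with the selected ones. *)
  assert (Hdom : forall i j i' j', selected f i j -> i' < n -> j' < n ->
    ~ selected f i' j' -> (i' < s \/ j' < s) -> (A i' + B j' <= A i + B j)%R).
  { intros i j i' j' Hsel Hi' Hj' Hns Hor.
    apply selected_cell in Hsel. destruct Hsel as (t & x & Ht & Hx & Hc).
    assert (Hval : forall t' x', before t x t' x' -> (val t' x' <= A i + B j)%R).
    { intros t' x' [Hlt|[Heq _]]; unfold val in *; rewrite Hc in *; simpl in *; lra. }
    destruct (le_lt_dec s i') as [Hge|Hlt].
    - specialize (Hval (s + j') i').
      rewrite val_col in Hval. apply Hval.
      apply Hb; try lia. unfold selected in Hns. lia.
    - specialize (Hval i' j').
      rewrite val_row in Hval by assumption.
      apply Hval. apply Hb; try lia. unfold selected in Hns. lia. }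
  split; [|split].
  - intros i j [[Hi Hj]|[Hj Hi]].
    + specialize (Hf i). lia.
    + specialize (Hf (s + j)). lia.
  - exists (prefix_cells f (2 * s)). split; [apply NoDup_prefix_cells|].
    split; [rewrite length_prefix_cells; exact Hs|].
    intros [i j]. simpl. rewrite in_prefix_cells, selected_cell. reflexivity.
  - intros i j i' j' Hsel Hi' Hj' Hns.
    destruct (le_lt_dec s i') as [Hsi|]; [|apply Hdom; auto].
    destruct (le_lt_dec s j') as [Hsj|]; [|apply Hdom; auto].
    destruct (Classical_Prop.classic (forall t, t < 2 * s -> S s <= f t)) as [Hall|Hex].
    + assert (Heq : forall t, t < 2 * s -> S s - start t = f t - start t).
      { apply sumf_le_eq.
        - intros t Ht. specialize (Hall t Ht). lia.
        - rewrite Hs. replace (2 * s) with (s + s) by lia. rewrite sumf_add.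
          rewrite (sumf_ext _ (fun _ => S s)),
            (sumf_ext (fun t => S s - start (s + t)) (fun _ => 1)).
          + rewrite !sumf_const. lia.
          + intros t Ht. unfold start. rewrite (proj2 (Nat.ltb_ge (s + t) s)); lia.
          + intros t Ht. unfold start. rewrite (proj2 (Nat.ltb_lt t s)); lia. }
      assert (Hle : i <= s /\ j <= s).
      { unfold start in *. destruct Hsel as [[Hi Hj]|[Hj Hi]].
        - specialize (Heq i ltac:(lia)). specialize (Hall i ltac:(lia)).
          destruct (i <? s); lia.
        - specialize (Heq (s + j) ltac:(lia)). specialize (Hall (s + j) ltac:(lia)).
          destruct (s + j <? s); lia. }
      pose proof (sortA i i' ltac:(lia)). pose proof (sortB j j' ltac:(lia)). lra.
    + assert (Hex' : exists t, t < 2 * s /\ f t <= s).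
      { apply Classical_Pred_Type.not_all_ex_not in Hex. destruct Hex as (t & Ht).
        exists t. lia. }
      destruct Hex' as (t & Ht & Hft).
      (* List [t] stops before index [s]: its cell at position [s] is unselected and dominates the
         cell [(i', j')]. *)
      destruct (le_lt_dec s t) as [Hge|Hlt].
      * assert (Hc : (A s + B (t - s) <= A i + B j)%R).
        { apply Hdom; auto; try lia. unfold selected.
          replace (s + (t - s)) with t by lia. lia. }
        pose proof (sortA s i' ltac:(lia)). pose proof (sortB (t - s) j' ltac:(lia)). lra.
      * assert (Hc : (A t + B s <= A i + B j)%R).
        { apply Hdom; auto; try lia. unfold selected. lia. }
        pose proof (sortA t i' ltac:(lia)). pose proof (sortB s j' ltac:(lia)). lra.
Qed.

End Lists.

(** * The programs *)

(* Registers 2 to 7 are those of the output encoding; [vw] is the block length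
   and [vq] the number of elements still to be selected. *)
Local Notation vn := 0 (only parsing).
Local Notation vk := 1 (only parsing).
Local Notation vnr := 3 (only parsing).
Local Notation vnc := 5 (only parsing).
Local Notation vrb := 6 (only parsing).
Local Notation vcb := 7 (only parsing).
Local Notation vs := 8 (only parsing).
Local Notation vm := 9 (only parsing).
Local Notation vw := 10 (only parsing).
Local Notation vq := 11 (only parsing).
Local Notation vt := 12 (only parsing).
Local Notation vv := 13 (only parsing).
Local Notation vx := 14 (only parsing).
Local Notation vy := 15 (only parsing).
Local Notation vpx := 16 (only parsing).
Local Notation vpy := 17 (only parsing).
Local Notation vix := 18 (only parsing).
Local Notation vjx := 19 (only parsing).
Local Notation viy := 20 (only parsing).
Local Notation vjy := 21 (only parsing).

Definition locate (x p i j : nat) : cmd :=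
  If (V x < V vs) (i <~ V x ;; j <~ V p) (i <~ V p ;; j <~ V x - V vs).

(* With [m = 2 s] lists, heap cells [2 t] and [2 t + 1] hold the start and the
   current end of list [t]; cell [2 m + v] holds the winner at node [v] of the
   tournament tree with root [1] and leaves [m, ..., 2 m - 1]. *)
Definition pull : cmd :=
  vx <~ H (2 * V vm + 2 * V vv) ;;
  vy <~ H (2 * V vm + (2 * V vv + 1)) ;;
  vpx <~ H (2 * V vx + 1) + V vw - 1 ;;
  vpy <~ H (2 * V vy + 1) + V vw - 1 ;;
  locate vx vpx vix vjx ;;
  locate vy vpy viy vjy ;;
  If (V vpy < V vn)
    (If (V vpx < V vn)
       (If (TSum (V vix) (V vjx) (V viy) (V vjy)) (vx <~ V vy)
          (If (TSum (V viy) (V vjy) (V vix) (V vjx)) Skip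
             (If (V vy < V vx) (vx <~ V vy) Skip)))
       (vx <~ V vy))
    Skip ;;
  heap (2 * V vm + V vv) <~ V vx.

(** Row lists need no initialization: their start and end are 0, as is the fresh heap. Counting up
    to [s] is affordable since O(s) steps are available. The final [vw] exceeds [k], hence k <= m (w
    - 1). *)
Definition setup : cmd :=
  While ((V vs + 1) * (V vs + 1) < V vk + 1) (vs <~ V vs + 1) ;;
  vm <~ 2 * V vs ;;
  vt <~ V vs ;;
  While (V vt < V vm)
    (heap (2 * V vt) <~ V vs ;; heap (2 * V vt + 1) <~ V vs ;; vt <~ V vt + 1) ;;
  vt <~ 0 ;;
  While (V vt < V vm)
    (heap (2 * V vm + (V vm + V vt)) <~ V vt ;; vt <~ V vt + 1) ;;
  vw <~ 1 ;;
  While (V vw < V vk + 1) (vw <~ 2 * V vw) ;;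
  vq <~ V vk.

Definition build : cmd :=
  vv <~ V vm ;;
  While (1 < V vv) (vv <~ V vv - 1 ;; pull).

(** Only the candidate of the winning list changes, so it suffices to replay the matches on the path
    from the parent of its leaf to the root; the loop stops when halving the root gives 0. *)
Definition accept : cmd :=
  vt <~ H (2 * V vm + 1) ;;
  heap (2 * V vt + 1) <~ H (2 * V vt + 1) + V vw ;;
  vq <~ V vq - V vw ;;
  vv <~ (V vm + V vt) / 2 ;;
  While (0 < V vv) (pull ;; vv <~ V vv / 2).

(** Candidates depend on the block length, so each phase rebuilds the tree. *)
Definition phases : cmd :=
  While (1 < V vw)
    (vw <~ V vw / 2 ;;
     build ;;
     While (V vm * (V vw - 1) < V vq) accept).

(** With truncated subtraction, the product is positive exactly when [vt] is a row list and its end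
    is positive. Ends become inclusive, and an empty row would then wrongly show column 0; hence
    [vnr] counts only nonempty rows. An empty column gets the range from [s] to [s - 1], which is
    empty. Address 64 is heap cell 0, and the column lists begin at heap cell [2 * s]. *)
Definition encode : cmd :=
  vnc <~ V vs ;;
  vrb <~ 64 ;;
  vcb <~ 64 + V vm ;;
  vt <~ 0 ;;
  While (V vt < V vm)
    (If (0 < (V vs - V vt) * H (2 * V vt + 1)) (vnr <~ V vt + 1) Skip ;;
     heap (2 * V vt + 1) <~ H (2 * V vt + 1) - 1 ;;
     vt <~ V vt + 1).

Definition select_prog : cmd := setup ;; phases ;; encode.

Definition report_list (i j : nexp) : cmd :=
  vx <~ H (2 * V vt) ;;
  While (V vx < H (2 * V vt + 1) + 1) (Print i j ;; vx <~ V vx + 1) ;;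
  vt <~ V vt + 1.

Definition report_prog : cmd :=
  vt <~ 0 ;;
  While (V vt < V vnr) (report_list (V vt) (V vx)) ;;
  vt <~ V vs ;;
  While (V vt < V vm) (report_list (V vx) (V vt - V vs)).

(** * Correctness of the selection: symbolic execution, tournament tree, phases *)

Ltac ev := cbn [eval nth setl op_fun holds sv hp ou] in *.

Ltac sym1 :=
  lazymatch goal with
  | |- ok _ _ (Seq _ _) _ _ => apply ok_seq
  | |- ok _ _ Skip _ _ => apply ok_skip
  | |- ok _ _ (Assign _ _) _ _ => apply ok_assign
  | |- ok _ _ (Store _ _) _ _ => apply ok_store
  | |- ok _ _ (Print _ _) _ _ => apply ok_print
  | |- ok _ _ (If _ _ _) _ _ => apply ok_if; let Hb := fresh "Hb" in intros Hb
  end; ev.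
Ltac sym := repeat sym1.

(** In heap numbering the parent of [v] is [v / 2]; every node is its own ancestor. *)
Definition anc (u v : nat) : Prop := exists d, v / 2 ^ d = u.

Lemma anc_refl u : anc u u.
Proof. exists 0. apply Nat.div_1_r. Qed.

Lemma anc_half u v : anc u v -> anc (u / 2) v.
Proof.
  intros (d & Hd). exists (S d). rewrite <- Hd, Nat.Div0.div_div.
  f_equal. simpl. lia.
Qed.

Lemma anc_inv u v : anc u v -> u = v \/ anc u (v / 2).
Proof.
  intros ([|d] & Hd); [left|right].
  - rewrite <- Hd. apply Nat.div_1_r.
  - exists d. rewrite Nat.Div0.div_div. exact Hd.
Qed.

Lemma half_cases v : v = 2 * (v / 2) \/ v = 2 * (v / 2) + 1.
Proof. pose proof (Nat.div_mod_eq v 2). pose proof (Nat.mod_upper_bound v 2). lia. Qed.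

Lemma half_double v : 2 * v / 2 = v.
Proof. rewrite Nat.mul_comm. apply Nat.div_mul. lia. Qed.

Lemma half_double_succ v : (2 * v + 1) / 2 = v.
Proof.
  rewrite Nat.add_comm, (Nat.mul_comm 2 v), Nat.div_add by lia. reflexivity.
Qed.

Section Select.
Variables (n k s : nat) (A B : nat -> R) (f : nat -> nat).
Hypothesis sortA : sorted_noninc n A.
Hypothesis sortB : sorted_noninc n B.
Hypothesis s_pos : 1 <= s.
Hypothesis s_le_n : s <= n.
Hypothesis s_sqrt : s * s <= k < S s * S s.
Hypothesis f_profile : profile n s A B f k.

Local Notation m := (2 * s).
Local Notation ok := (ok A B).

(** A snapshot during selection: the scratch registers of [pull] are hidden, those of the output
    encoding are still 0. *)
Definition work (w q t v : nat) (h : nat -> nat) (st : mem) : Prop :=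
  exists x y px py ix jx iy jy,
    st = Mem [n; k; 0; 0; 0; 0; 0; 0; s; m; w; q; t; v; x; y; px; py; ix; jx; iy; jy] h [].

Definition lists (lo h : nat -> nat) : Prop :=
  forall t, t < m -> h (2 * t) = start s t /\ h (2 * t + 1) = lo t.

Definition leaves (h : nat -> nat) : Prop :=
  forall t, t < m -> h (2 * m + (m + t)) = t.

(** The winner stored at [v] comes from a leaf below [v]. This locality confines the effect of
    changing one list to the ancestors of its leaf. *)
Definition node (h : nat -> nat) (v : nat) : Prop :=
  h (2 * m + v) < m /\ anc v (m + h (2 * m + v)).

Definition good (w : nat) (lo h : nat -> nat) (v : nat) : Prop :=
  noworse n s A B w lo (h (2 * m + v)) (h (2 * m + 2 * v)) /\
  noworse n s A B w lo (h (2 * m + v)) (h (2 * m + (2 * v + 1))).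

Lemma locate_ok x p i j l h o (Q : mem -> nat -> Prop) :
  nth vs l 0 = s -> Nat.eqb x i = false -> Nat.eqb p i = false ->
  Nat.eqb vs i = false ->
  Q (Mem (setl (setl l i (fst (cell s (nth x l 0) (nth p l 0))))
            j (snd (cell s (nth x l 0) (nth p l 0)))) h o) 3 ->
  ok (locate x p i j) (Mem l h o) Q.
Proof.
  intros Hs Hx Hp Hi HQ. unfold locate, cell in *. apply ok_if; intros Hb;
    cbn [holds eval] in Hb; rewrite Hs in Hb.
  - rewrite (proj2 (Nat.ltb_lt _ _) Hb) in HQ.
    apply ok_seq, ok_assign, ok_assign. cbn [eval]. rewrite nth_setl, Hp. exact HQ.
  - rewrite (proj2 (Nat.ltb_ge _ _)) in HQ by lia.
    apply ok_seq, ok_assign, ok_assign. cbn [eval op_fun].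
    rewrite !nth_setl, Hx, Hi, Hs. exact HQ.
Qed.

Lemma pull_ok w q t v h lo st : work w q t v h st -> lists lo h ->
  1 <= v < m -> node h (2 * v) -> node h (2 * v + 1) ->
  ok pull st (fun st' d => d <= 20 /\ exists z,
    work w q t v (upd h (2 * m + v) z) st'
    /\ lists lo (upd h (2 * m + v) z)
    /\ node (upd h (2 * m + v) z) v
    /\ good w lo (upd h (2 * m + v) z) v).
Proof.
  intros (x0 & y0 & px0 & py0 & ix0 & jx0 & iy0 & jy0 & ->) Hl Hv [Hx Hax] [Hy Hay].
  set (x := h (2 * m + 2 * v)) in *. set (y := h (2 * m + (2 * v + 1))) in *.
  assert (Hmain : forall z, (z = x \/ z = y) ->
    noworse n s A B w lo z x -> noworse n s A B w lo z y ->
    lists lo (upd h (2 * m + v) z) /\ node (upd h (2 * m + v) z) v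
    /\ good w lo (upd h (2 * m + v) z) v).
  { intros z Hz Hzx Hzy. split; [|split].
    - intros u Hu. rewrite !upd_other by lia. apply Hl, Hu.
    - unfold node. rewrite upd_same. split; [destruct Hz; subst; assumption|].
      destruct Hz as [->| ->].
      + apply anc_half in Hax. rewrite half_double in Hax. exact Hax.
      + apply anc_half in Hay. rewrite half_double_succ in Hay. exact Hay.
    - unfold good. rewrite upd_same, !upd_other by lia. auto. }
  assert (Hpx : h (2 * x + 1) + w - 1 = cand w lo x)
    by (unfold cand; rewrite (proj2 (Hl x Hx)); reflexivity).
  assert (Hpy : h (2 * y + 1) + w - 1 = cand w lo y)
    by (unfold cand; rewrite (proj2 (Hl y Hy)); reflexivity).
  unfold pull. do 8 sym1. fold x. fold y. rewrite Hpx, Hpy.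
  sym1. apply locate_ok; [reflexivity..|]. ev. sym1. apply locate_ok; [reflexivity..|]. ev.
  assert (Hxy : noworse n s A B w lo x y -> exists z, work w q t v (upd h (2 * m + v) z)
     (Mem [n; k; 0; 0; 0; 0; 0; 0; s; m; w; q; t; v; x; y;
           cand w lo x; cand w lo y; fst (cell s x (cand w lo x));
           snd (cell s x (cand w lo x)); fst (cell s y (cand w lo y));
           snd (cell s y (cand w lo y))] (upd h (2 * m + v) x) []) /\
     lists lo (upd h (2 * m + v) z) /\
     node (upd h (2 * m + v) z) v /\ good w lo (upd h (2 * m + v) z) v).
  { intros Hn. exists x. split; [repeat eexists|]. auto using noworse_refl. }
  assert (Hyx : noworse n s A B w lo y x -> exists z, work w q t v (upd h (2 * m + v) z)
     (Mem [n; k; 0; 0; 0; 0; 0; 0; s; m; w; q; t; v; y; y;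
           cand w lo x; cand w lo y; fst (cell s x (cand w lo x));
           snd (cell s x (cand w lo x)); fst (cell s y (cand w lo y));
           snd (cell s y (cand w lo y))] (upd h (2 * m + v) y) []) /\
     lists lo (upd h (2 * m + v) z) /\
     node (upd h (2 * m + v) z) v /\ good w lo (upd h (2 * m + v) z) v).
  { intros Hn. exists y. split; [repeat eexists|]. auto using noworse_refl. }
  (* If both sum tests fail the sums are equal, and the smaller index wins, as [before] demands.
     Against an exhausted list [noworse] holds vacuously. *)
  unfold noworse, before, val in Hxy, Hyx.
  sym; (split; [lia|]).
  - apply Hyx. auto.
  - apply Hxy. auto.
  - apply Hyx. intros _. split; [assumption|]. right. right. split; [lra|auto].
  - apply Hxy. intros _. split; [assumption|].
    destruct (Nat.eq_dec x y); [auto|]. right. right. split; [lra|lia].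
  - apply Hyx. intros Hc. contradiction.
  - apply Hxy. intros Hc. contradiction.
Qed.

Lemma node_upd h u v z : u <> v -> node h u -> node (upd h (2 * m + v) z) u.
Proof. intros Hne. unfold node. rewrite upd_other by lia. auto. Qed.

(** [good] at [u] reads the cells of [u] and of its two children, so a write at [v] affects only [v]
    and its parent. *)
Lemma good_upd w lo h u v z : u <> v -> u <> v / 2 ->
  good w lo h u -> good w lo (upd h (2 * m + v) z) u.
Proof.
  intros Hne Hp. unfold good.
  assert (2 * u <> v) by (intros <-; rewrite half_double in Hp; lia).
  assert (2 * u + 1 <> v) by (intros <-; rewrite half_double_succ in Hp; lia).
  rewrite !upd_other by lia. auto.
Qed.

Lemma leaves_upd h v z : v < m -> leaves h -> leaves (upd h (2 * m + v) z).
Proof. intros Hv Hl t Ht. rewrite upd_other by lia. apply Hl, Ht. Qed.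

Lemma leaves_node h u : leaves h -> m <= u < 2 * m -> node h u.
Proof.
  intros Hl Hu. unfold node. replace u with (m + (u - m)) by lia.
  rewrite Hl by lia. split; [lia|]. apply anc_refl.
Qed.

Definition tree (w : nat) (lo h : nat -> nat) : Prop :=
  lists lo h /\ leaves h /\ (forall u, 1 <= u < 2 * m -> node h u) /\
  (forall u, 1 <= u < m -> good w lo h u).

Lemma build_ok w q t v h lo st : work w q t v h st -> lists lo h -> leaves h ->
  ok build st (fun st' d => d <= 22 * m + 2 /\
    exists v' h', work w q t v' h' st' /\ tree w lo h').
Proof.
  intros (x & y & px & py & ix & jx & iy & jy & ->) Hl Hlv. unfold build. do 2 sym1.
  eapply ok_mono.
  (* Nodes are processed downwards from [m - 1] to 1, so both children of a node are ready before
     it. *)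
  { apply (ok_while A B _ _ (fun j st' => exists v' h', work w q t v' h' st' /\ lists lo h'
      /\ leaves h' /\ (forall u, v' <= u < 2 * m -> node h' u)
      /\ (forall u, v' <= u < m -> good w lo h' u) /\ v' = 1 + j /\ v' <= m) 21)
      with (n := m - 1).
    - clear h x y px py ix jx iy jy v Hl Hlv.
      intros j l h o (v & h' & (x & y & px & py & ix & jx & iy & jy & [= -> -> ->])
        & Hl & Hlv & Hn & Hg & Hv & Hvm) Hb. ev.
      exists (j - 1). split; [lia|].
      do 2 sym1. eapply ok_mono.
      + apply (pull_ok w q t (v - 1) h' lo); [repeat eexists|assumption|lia| |];
          apply Hn; lia.
      + intros st d (Hd & z & Hw & Hl' & Hn' & Hg'). split; [|lia].
        exists (v - 1), (upd h' (2 * m + (v - 1)) z). split; [assumption|].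
        split; [assumption|]. split; [apply leaves_upd; [lia|assumption]|].
        assert (Hhalf : (v - 1) / 2 < v - 1) by (apply Nat.div_lt; lia).
        split; [intros u Hu|split; [intros u Hu|lia]].
        * destruct (Nat.eq_dec u (v - 1)) as [->|]; [assumption|].
          apply node_upd; [assumption|apply Hn; lia].
        * destruct (Nat.eq_dec u (v - 1)) as [->|]; [assumption|].
          apply good_upd; [assumption|lia|apply Hg; lia].
    - exists m, h. split; [repeat eexists|]. split; [assumption|]. split; [assumption|].
      split; [intros u Hu; apply leaves_node; assumption|].
      split; [intros; lia|lia]. }
  intros st d ((j & v' & h' & (x' & y' & px' & py' & ix' & jx' & iy' & jy' & ->)
    & Hl' & Hlv' & Hn' & Hg' & Hv' & Hvm) & Hb & Hd). ev.
  split; [lia|]. exists v', h'. split; [repeat eexists|].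
  replace v' with 1 in * by lia. split; [assumption|]. split; [assumption|]. split; assumption.
Qed.

(** Local wins compose by transitivity along the path from the root to each leaf. *)
Lemma tree_root w lo h : tree w lo h ->
  forall t, t < m -> noworse n s A B w lo (h (2 * m + 1)) t.
Proof.
  intros (_ & Hlv & _ & Hg).
  assert (Hall : forall v, 1 <= v < 2 * m ->
    noworse n s A B w lo (h (2 * m + 1)) (h (2 * m + v))).
  { induction v as [v IH] using (well_founded_induction lt_wf). intros Hv.
    destruct (Nat.eq_dec v 1) as [->|Hne]; [apply noworse_refl|].
    pose proof (half_cases v) as Hc.
    eapply noworse_trans; [apply (IH (v / 2)); lia|].
    destruct (Hg (v / 2) ltac:(lia)) as [Hg1 Hg2].
    destruct Hc as [Hc|Hc]; rewrite <- Hc in *; assumption. }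
  intros t Ht. rewrite <- (Hlv t Ht). apply Hall. lia.
Qed.

Definition bounded (lo : nat -> nat) (q : nat) : Prop :=
  (forall u, u < m -> start s u <= lo u <= f u) /\ sumf (fun u => f u - lo u) m = q.

(* Outside the ancestors of a leaf, nodes do not refer to its list. *)
Lemma good_other w lo lo' h t u : (forall v, v <> t -> lo' v = lo v) -> t < m ->
  (forall u, 1 <= u < 2 * m -> node h u) -> 1 <= u < m -> ~ anc u ((m + t) / 2) ->
  good w lo h u -> good w lo' h u.
Proof.
  intros Hlo Ht Hn Hu Hanc.
  assert (Hanc' : ~ anc u (m + t)).
  { intros Ha. apply anc_inv in Ha. destruct Ha; [lia|auto]. }
  assert (Hkey : forall x, anc x (m + t) -> x / 2 = u -> False).
  { intros x Hx <-. apply Hanc', anc_half, Hx. }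
  assert (h (2 * m + u) <> t).
  { intros Heq. destruct (Hn u ltac:(lia)) as [_ Ha]. rewrite Heq in Ha. auto. }
  assert (h (2 * m + 2 * u) <> t).
  { intros Heq. destruct (Hn (2 * u) ltac:(lia)) as [_ Ha]. rewrite Heq in Ha.
    apply (Hkey _ Ha), half_double. }
  assert (h (2 * m + (2 * u + 1)) <> t).
  { intros Heq. destruct (Hn (2 * u + 1) ltac:(lia)) as [_ Ha]. rewrite Heq in Ha.
    apply (Hkey _ Ha), half_double_succ. }
  unfold good, noworse, cand. rewrite !Hlo by assumption. auto.
Qed.

Definition depth : nat := S (Nat.log2 m).

Lemma m_lt_depth : m < 2 ^ depth.
Proof. apply Nat.log2_spec. lia. Qed.

(** By [block_accept] the winner's block lies below [f], so [bounded] is preserved. During the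
    replay [good] holds except at the ancestors of the current node. *)
Lemma accept_ok w q t v h lo st : work w q t v h st -> tree w lo h ->
  bounded lo q -> 1 <= w -> m * (w - 1) < q ->
  ok accept st (fun st' d => d <= 22 * depth + 5 /\
    exists t' v' h' lo', work w (q - w) t' v' h' st' /\ tree w lo' h' /\
      bounded lo' (q - w) /\ w <= q).
Proof.
  intros (x & y & px & py & ix & jx & iy & jy & ->) Ht (Hlo & Hq) Hw Hwq.
  assert (Hroot := tree_root _ _ _ Ht). destruct Ht as (Hl & Hlv & Hn & Hg).
  unfold accept. do 8 sym1.
  destruct (Hn 1 ltac:(lia)) as [Htm _].
  set (t' := h (2 * m + 1)) in *.
  assert (Hacc : lo t' + w <= f t') by
    (eapply block_accept with (n := n) (s := s) (A := A) (B := B) (q := k) (lo := lo);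
       try eassumption; rewrite Hq; assumption).
  set (lo' := upd lo t' (lo t' + w)).
  set (h1 := upd h (2 * t' + 1) (h (2 * t' + 1) + w)).
  assert (Hlo' : forall v, v <> t' -> lo' v = lo v) by (intros; apply upd_other; assumption).
  assert (Hh1 : forall u, 1 <= u -> h1 (2 * m + u) = h (2 * m + u)).
  { intros u Hu. apply upd_other. lia. }
  assert (Hl1 : lists lo' h1).
  { intros u Hu. unfold h1, lo'. rewrite (upd_other _ _ _ (2 * u)) by lia.
    split; [apply Hl, Hu|]. destruct (Nat.eq_dec u t') as [->|].
    - rewrite !upd_same, (proj2 (Hl t' Htm)). reflexivity.
    - rewrite !upd_other by lia. apply Hl, Hu. }
  assert (Hhalf : (m + t') / 2 < m) by (apply Nat.Div0.div_lt_upper_bound; lia).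
  eapply ok_mono.
  { apply (ok_while A B _ _ (fun j st' => exists v' h', work w (q - w) t' v' h' st' /\
      lists lo' h' /\ leaves h' /\ (forall u, 1 <= u < 2 * m -> node h' u) /\
      (forall u, 1 <= u < m -> ~ anc u v' -> good w lo' h' u) /\ v' < m /\ v' < 2 ^ j) 21)
      with (n := depth).
    - clear x y px py ix jx iy jy v Hl Hlv Hn Hg Hh1 Hl1 Hhalf.
      intros j l h2 o (v & h' & (x & y & px & py & ix & jx & iy & jy & [= -> -> ->])
        & Hl & Hlv & Hn & Hg & Hvm & Hvj) Hb. ev.
      destruct j as [|j]; [simpl in Hvj; lia|]. exists j. split; [reflexivity|].
      sym1. eapply ok_mono.
      { apply (pull_ok w (q - w) t' v h' lo'); [repeat eexists|assumption|lia| |];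
          apply Hn; lia. }
      intros st d (Hd & z & (x' & y' & px' & py' & ix' & jx' & iy' & jy' & ->) & Hl' & Hn' & Hg').
      sym1. split; [|lia].
      assert (Hhalf : v / 2 < v) by (apply Nat.div_lt; lia).
      exists (v / 2), (upd h' (2 * m + v) z). split; [repeat eexists|].
      split; [assumption|]. split; [apply leaves_upd; [lia|assumption]|].
      split; [|split; [|split; [lia|]]].
      + intros u Hu. destruct (Nat.eq_dec u v) as [->|]; [assumption|].
        apply node_upd; [assumption|apply Hn; lia].
      + intros u Hu Ha. destruct (Nat.eq_dec u v) as [->|Hne]; [assumption|].
        apply good_upd; [assumption| |].
        * intros ->. apply Ha, anc_refl.
        * apply Hg; [assumption|]. intros Hb'. apply anc_inv in Hb'. tauto.
      + simpl in Hvj. apply Nat.Div0.div_lt_upper_bound. lia.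
    - exists ((m + t') / 2), h1. split; [repeat eexists|]. split; [assumption|].
      split; [intros u Hu; rewrite Hh1 by lia; apply Hlv, Hu|].
      split; [intros u Hu; unfold node; rewrite Hh1 by lia; apply Hn, Hu|].
      split; [|split; [assumption|pose proof m_lt_depth; lia]].
      intros u Hu Ha. unfold good. rewrite !Hh1 by lia.
      exact (good_other w lo lo' h t' u Hlo' Htm Hn Hu Ha (Hg u Hu)). }
  intros st d ((j & v' & h' & (x' & y' & px' & py' & ix' & jx' & iy' & jy' & ->)
    & Hl' & Hlv' & Hn' & Hg' & _) & Hb & Hd). ev.
  split; [lia|]. exists t', v', h', lo'. split; [repeat eexists|].
  split; [split; [assumption|]; split; [assumption|]; split; [assumption|]|].
  (* The loop ends at node 0, which has no positive ancestor, so no exception is left. *)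
  { intros u Hu. apply Hg'; [assumption|]. intros (e & He).
    replace v' with 0 in He by lia. rewrite Nat.Div0.div_0_l in He. lia. }
  assert (Hsum : sumf (fun u => f u - lo u) m = sumf (fun u => f u - lo' u) m + w).
  { apply sumf_change with (t := t'); [assumption| |].
    - intros u Hu Hne. rewrite Hlo' by assumption. reflexivity.
    - unfold lo'. rewrite upd_same. lia. }
  split; [split|]; [|lia|lia].
  intros u Hu. unfold lo', upd. destruct (Nat.eqb_spec u t') as [->|]; specialize (Hlo _ Hu); lia.
Qed.

Lemma phases_ok J w q t v h lo st : work w q t v h st -> lists lo h -> leaves h ->
  bounded lo q -> w = 2 ^ J -> q <= m * (w - 1) ->
  ok phases st (fun st' d =>
    d <= (22 * m + 8 + (22 * depth + 6) * m + 1) * J + 1 /\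
    exists w' t' v' h' lo', work w' 0 t' v' h' st' /\ lists lo' h' /\ bounded lo' 0).
Proof.
  intros Hw Hl Hlv Hb Hj Hq. unfold phases.
  eapply ok_mono.
  { apply (ok_while A B _ _ (fun j st' => exists w' q' t' v' h' lo', work w' q' t' v' h' st' /\
      lists lo' h' /\ leaves h' /\ bounded lo' q' /\ w' = 2 ^ j /\ q' <= m * (w' - 1))
      (22 * m + 8 + (22 * depth + 6) * m)) with (n := J).
    - clear J w q t v h lo st Hw Hl Hlv Hb Hj Hq.
      intros j l h2 o (w & q & t & v & h & lo &
        (x & y & px & py & ix & jx & iy & jy & [= -> -> ->]) & Hl & Hlv & Hbd & Hw & Hq) Hb. ev.
      destruct j as [|j]; [simpl in Hw; lia|]. exists j. split; [reflexivity|].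
      assert (Hw2 : w = 2 * 2 ^ j) by exact Hw.
      do 3 sym1. replace (w / 2) with (2 ^ j) by (rewrite Hw2, half_double; reflexivity).
      assert (Hpos : 2 ^ j <> 0) by (apply Nat.pow_nonzero; lia).
      remember (2 ^ j) as u eqn:Hu.
      eapply ok_mono.
      { apply (build_ok u q t v h lo); [repeat eexists|assumption|assumption]. }
      intros st d (Hd & v' & h' & Hwork & Htree). eapply ok_mono.
      (* The previous phase left [q <= m * (2 * u - 1)], that is, [m * (u - 1) + u * m]. Each
         acceptance removes [u], so at most [m] occur. *)
      { apply (ok_while A B _ _ (fun i st' => exists q' t' v' h' lo', work u q' t' v' h' st' /\
          tree u lo' h' /\ bounded lo' q' /\ q' <= m * (u - 1) + u * i) (22 * depth + 5))
          with (n := m).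
        - clear - sortA sortB s_pos s_le_n s_sqrt f_profile Hpos.
          intros i l h2 o (q & t & v & h & lo & Hwork & Htree & Hbd & Hq) Hb.
          assert (Hwork' := Hwork).
          destruct Hwork' as (x & y & px & py & ix & jx & iy & jy & [= -> _ _]). ev.
          destruct i as [|i]; [lia|]. exists i. split; [reflexivity|].
          eapply ok_mono; [apply (accept_ok u q t v h lo); auto; lia|].
          intros st d (Hd & t' & v' & h' & lo' & Hwork' & Htree' & Hbd' & Hle).
          split; [|exact Hd]. exists (q - u), t', v', h', lo'. split; [assumption|].
          split; [assumption|]. split; [assumption|nia].
        - exists q, t, v', h', lo. split; [assumption|]. split; [assumption|].
          split; [assumption|nia]. }
      intros st2 d2 ((i & q2 & t2 & v2 & h2 & lo2 & Hwork2 & (Hl2 & Hlv2 & _) & Hbd2 & _)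
        & Hb2 & Hd2).
      split; [|lia]. exists u, q2, t2, v2, h2, lo2. split; [assumption|].
      split; [assumption|]. split; [assumption|]. split; [assumption|]. split; [reflexivity|].
      destruct Hwork2 as (x2 & y2 & px2 & py2 & ix2 & jx2 & iy2 & jy2 & ->). ev. lia.
    - exists w, q, t, v, h, lo. auto 10. }
  intros st' d ((j & w' & q' & t' & v' & h' & lo' & (x & y & px & py & ix & jx & iy & jy & ->)
    & Hl' & _ & Hbd' & Hw' & Hq') & Hb' & Hd). ev.
  (* The loop ends with [w' = 1], where the bound [m * (w' - 1)] is 0. *)
  split; [lia|]. assert (q' = 0) by nia. subst q'.
  exists w', t', v', h', lo'. split; [repeat eexists|]. auto.
Qed.

Lemma setup_ok :
  ok setup (Mem [n; k; 0; 0; 0; 0; 0; 0; 0; 0; 0; 0; 0; 0; 0; 0; 0; 0; 0; 0; 0; 0] (fun _ => 0) [])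
  (fun st d => d <= 13 * s + 2 * Nat.log2 k + 20 /\
  exists t v h, work (2 ^ S (Nat.log2 k)) k t v h st /\ lists (start s) h /\ leaves h).
Proof.
  assert (Hlog : 2 ^ Nat.log2 k <= k < 2 ^ S (Nat.log2 k)) by (apply Nat.log2_spec; nia).
  remember (Nat.log2 k) as lg eqn:Elg. clear Elg.
  unfold setup. sym1. eapply ok_mono.
  { apply (ok_while A B _ _ (fun j st' => exists u, st' = Mem [n; k; 0; 0; 0; 0; 0; 0; u; 0;
      0; 0; 0; 0; 0; 0; 0; 0; 0; 0; 0; 0] (fun _ => 0) [] /\ j = s - u /\ u <= s) 1)
      with (n := s).
    - intros j l h o (u & [= -> -> ->] & -> & Hu) Hb. ev.
      assert (u < s) by nia. exists (s - S u). split; [lia|].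
      sym. split; [|lia]. exists (u + 1). split; [reflexivity|]. lia.
    - exists 0. split; [reflexivity|]. lia. }
  intros st d1 ((j & u & -> & Hj & Hu) & Hb & Hd1). ev.
  assert (u = s) by nia. subst u. clear Hb Hu Hj j.
  do 5 sym1. eapply ok_mono.
  { apply (ok_while A B _ _ (fun j st' => exists t h, st' = Mem [n; k; 0; 0; 0; 0; 0; 0; s; m;
      0; 0; t; 0; 0; 0; 0; 0; 0; 0; 0; 0] h [] /\ j = m - t /\ s <= t <= m /\
      forall u, h (2 * u) = (if u <? t then start s u else 0) /\
                h (2 * u + 1) = (if u <? t then start s u else 0)) 3) with (n := s).
    - intros j l h2 o (t & h & [= -> -> ->] & -> & Ht & Hh) Hb. ev.
      exists (m - S t). split; [lia|]. sym. split; [|lia].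
      exists (t + 1), (upd (upd h (2 * t) s) (2 * t + 1) s). split; [reflexivity|].
      split; [lia|]. split; [lia|]. intros u.
      rewrite (upd_other _ _ _ (2 * u)) by lia.
      destruct (Nat.eq_dec u t) as [->|Hne].
      + rewrite !upd_same, (proj2 (Nat.ltb_lt t (t + 1))) by lia.
        unfold start. rewrite (proj2 (Nat.ltb_ge t s)) by lia. auto.
      + rewrite !upd_other by lia. rewrite (proj1 (Hh u)), (proj2 (Hh u)).
        destruct (Nat.ltb_spec u t), (Nat.ltb_spec u (t + 1)); auto; lia.
    - exists s, (fun _ => 0). split; [reflexivity|]. split; [lia|]. split; [lia|].
      (* For row lists the zero heap already holds the right values. *)
      intros u. unfold start. destruct (u <? s); auto. }
  intros st d2 ((j & t & h & -> & Hj & Ht & Hh) & Hb & Hd2). ev.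
  do 3 sym1. eapply ok_mono.
  { apply (ok_while A B _ _ (fun j st' => exists t h, st' = Mem [n; k; 0; 0; 0; 0; 0; 0; s; m;
      0; 0; t; 0; 0; 0; 0; 0; 0; 0; 0; 0] h [] /\ j = m - t /\ t <= m /\
      lists (start s) h /\ forall u, u < t -> h (2 * m + (m + u)) = u) 2) with (n := m).
    - clear h t Hj Ht Hb Hh j. intros j l h2 o (t & h & [= -> -> ->] & -> & Ht & Hl & Hh) Hb. ev.
      exists (m - S t). split; [lia|]. sym. split; [|lia].
      exists (t + 1), (upd h (2 * m + (m + t)) t). split; [reflexivity|].
      split; [lia|]. split; [lia|]. split.
      + intros u Hu. rewrite !upd_other by lia. apply Hl, Hu.
      + intros u Hu. destruct (Nat.eq_dec u t) as [->|Hne]; [apply upd_same|].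
        rewrite upd_other by lia. apply Hh. lia.
    - exists 0, h. split; [reflexivity|]. split; [lia|]. split; [lia|].
      split; [|intros; lia]. intros u Hu.
      rewrite (proj1 (Hh u)), (proj2 (Hh u)), (proj2 (Nat.ltb_lt u t)) by lia. auto. }
  clear h t Hj Ht Hb Hh j.
  intros st d3 ((j & t & h & -> & Hj & Ht & Hl & Hh) & Hb & Hd3). ev.
  do 3 sym1. eapply ok_mono.
  { apply (ok_while A B _ _ (fun j st' => exists i, st' = Mem [n; k; 0; 0; 0; 0; 0; 0; s; m;
      2 ^ i; 0; t; 0; 0; 0; 0; 0; 0; 0; 0; 0] h [] /\ j = S lg - i /\ i <= S lg) 1)
      with (n := S lg).
    - clear j Hj. intros j l h2 o (i & [= -> -> ->] & -> & Hi) Hb'. ev.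
      assert (i <> S lg) by (intros ->; lia).
      exists (lg - i). split; [lia|]. sym. split; [|lia].
      exists (S i). split; [reflexivity|]. lia.
    - exists 0. split; [reflexivity|]. lia. }
  intros st d4 ((j' & i & -> & Hj' & Hi) & Hb' & Hd4). ev.
  assert (Hi' : i = S lg).
  { destruct (Nat.eq_dec i (S lg)) as [|Hne]; [assumption|].
    pose proof (Nat.pow_le_mono_r 2 i lg ltac:(lia) ltac:(lia)). lia. }
  subst i. sym. split; [lia|]. exists t, 0, h. split; [repeat eexists|].
  split; [assumption|]. intros u Hu. apply Hh. lia.
Qed.

Lemma encode_ok w t v h st : work w 0 t v h st -> lists f h -> 
  ok encode st (fun st' d => d <= 5 * m + 7 /\
    exists nr w q t v x y px py ix jx iy jy h',
      st' = Mem [n; k; 0; nr; 0; s; 64; 64 + m; s; m; w; q; t; v; x; y; px; py; ix; jx; iy; jy] h' []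
      /\ nr <= s /\ (forall u, u < nr -> 0 < f u) /\ (forall u, nr <= u < s -> f u = 0)
      /\ forall u, u < m -> h' (2 * u) = start s u /\ h' (2 * u + 1) = f u - 1).
Proof.
  intros (x & y & px & py & ix & jx & iy & jy & ->) Hl. unfold encode. do 8 sym1.
  eapply ok_mono.
  { apply (ok_while A B _ _ (fun j st' => exists nr t h',
      st' = Mem [n; k; 0; nr; 0; s; 64; 64 + m; s; m; w; 0; t; v; x; y; px; py; ix; jx; iy; jy] h' []
      /\ nr <= s /\ (forall u, u < nr -> 0 < f u) /\ (forall u, nr <= u < s -> u < t -> f u = 0)
      /\ nr <= t
      /\ (forall u, u < m -> h' (2 * u) = start s u /\
            h' (2 * u + 1) = if u <? t then f u - 1 else f u)
      /\ j = m - t /\ t <= m) 4) with (n := m).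
    - intros j l h2 o (nr & u & h' & [= -> -> ->] & Hnr & Hpos & Hzero & Hnu & Hh & -> & Hu) Hb. ev.
      exists (m - S u). split; [lia|].
      assert (Hhu : h' (2 * u + 1) = f u).
      { rewrite (proj2 (Hh u Hb)), Nat.ltb_irrefl. reflexivity. }
      assert (Hh' : forall u', u' < m -> upd h' (2 * u + 1) (f u - 1) (2 * u') = start s u' /\
        upd h' (2 * u + 1) (f u - 1) (2 * u' + 1) = if u' <? u + 1 then f u' - 1 else f u').
      { intros u' Hu'. rewrite (upd_other _ _ _ (2 * u')) by lia.
        split; [apply Hh, Hu'|]. destruct (Nat.eq_dec u' u) as [->|].
        - rewrite upd_same, (proj2 (Nat.ltb_lt u (u + 1))) by lia. reflexivity.
        - rewrite upd_other by lia. rewrite (proj2 (Hh u' Hu')).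
          destruct (Nat.ltb_spec u' u), (Nat.ltb_spec u' (u + 1)); auto; lia. }
      sym; rewrite Hhu in *; (split; [|lia]).
      + assert (Hus : u < s) by nia. assert (Hfu : 0 < f u) by nia.
        exists (u + 1), (u + 1), (upd h' (2 * u + 1) (f u - 1)). split; [reflexivity|].
        split; [lia|]. split.
        * intros u' Hu'. destruct (Nat.eq_dec u' u) as [->|]; [assumption|].
          destruct (le_lt_dec nr u') as [Hge|]; [|auto].
          destruct (Nat.eq_dec (f u') 0) as [Hz|]; [|lia].
          exfalso.
          (* Row ends are non-increasing, so a nonempty row cannot follow an empty one: the nonempty
             rows are an initial segment. *)
          assert (Hmono : forall i, u' + i < s -> f (u' + i) <= f u').
          { induction i as [|i IH]; intros Hi; [rewrite Nat.add_0_r; lia|].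
            rewrite Nat.add_succ_r in Hi |- *.
            assert (f (S (u' + i)) <= f (u' + i)).
            { eapply profile_rows with (n := n) (s := s) (A := A) (B := B) (q := k); eassumption. }
            specialize (IH ltac:(lia)). lia. }
          specialize (Hmono (u - u') ltac:(lia)).
          replace (u' + (u - u')) with u in Hmono by lia. lia.
        * split; [intros; lia|]. split; [lia|]. split; [assumption|lia].
      + exists nr, (u + 1), (upd h' (2 * u + 1) (f u - 1)). split; [reflexivity|].
        split; [assumption|]. split; [assumption|]. split.
        * intros u' Hu' Hlt. destruct (Nat.eq_dec u' u) as [->|]; [|apply Hzero; lia].
          nia.
        * split; [lia|]. split; [assumption|lia].
    - exists 0, 0, h. split; [reflexivity|]. split; [lia|]. split; [intros; lia|].
      split; [intros; lia|]. split; [lia|]. split; [|lia].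
      intros u Hu. exact (Hl u Hu). }
  intros st d ((j & nr & u & h' & -> & Hnr & Hpos & Hzero & Hnu & Hh & Hj & Hu) & Hb & Hd). ev.
  split; [lia|].
  exists nr, w, 0, u, v, x, y, px, py, ix, jx, iy, jy, h'. split; [reflexivity|].
  split; [assumption|]. split; [assumption|]. split; [intros; apply Hzero; lia|].
  intros u' Hu'. rewrite (proj2 (Hh u' Hu')), (proj2 (Nat.ltb_lt u' u)) by lia.
  split; [apply Hh, Hu'|reflexivity].
Qed.

End Select.

(** * Correctness of the report program *)

Section Report.
Variables (n k s : nat) (A B : nat -> R) (f : nat -> nat).
Hypothesis s_pos : 1 <= s.
Hypothesis f_profile : profile n s A B f k.
Local Notation m := (2 * s).
Variables (nr w q v y px py ix jx iy jy : nat) (h : nat -> nat).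
Hypothesis nr_le_s : nr <= s.
Hypothesis nr_pos : forall u, u < nr -> 0 < f u.
Hypothesis nr_zero : forall u, nr <= u < s -> f u = 0.
Hypothesis h_ends : forall u, u < m -> h (2 * u) = start s u /\ h (2 * u + 1) = f u - 1.

Let regs (t x : nat) : list nat :=
  [n; k; 0; nr; 0; s; 64; 64 + m; s; m; w; q; t; v; x; y; px; py; ix; jx; iy; jy].

Definition with_sum (p : nat * nat) : nat * nat * R := (p, (A (fst p) + B (snd p))%R).

Lemma prefix_cells_succ t : prefix_cells s f (S t) =
  prefix_cells s f t ++ map (cell s t) (seq (start s t) (f t - start s t)).
Proof.
  unfold prefix_cells. rewrite seq_S, flat_map_app. simpl. rewrite app_nil_r. reflexivity.
Qed.

(** Rows from [nr] on are empty, so a loop that stops at [nr] has printed all row cells. *)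
Lemma prefix_cells_nr : prefix_cells s f s = prefix_cells s f nr.
Proof.
  replace s with (nr + (s - nr)) at 2 by lia.
  assert (Hi : nr + (s - nr) <= s) by lia. revert Hi.
  induction (s - nr) as [|i IH]; intros Hi; [rewrite Nat.add_0_r; reflexivity|].
  rewrite Nat.add_succ_r, prefix_cells_succ, nr_zero, IH by lia.
  simpl. apply app_nil_r.
Qed.

Lemma report_list_ok i j t x : t < m -> 0 < f t ->
  (forall x, (eval (regs t x) h i, eval (regs t x) h j) = cell s t x) ->
  ok A B (report_list i j) (Mem (regs t x) h (map with_sum (prefix_cells s f t)))
    (fun st d => d <= 3 * (f t - start s t) + 3 /\
       exists x, st = Mem (regs (S t) x) h (map with_sum (prefix_cells s f (S t)))).
Proof.
  intros Ht Hpos Hcell. destruct (h_ends t Ht) as [Hs He].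
  assert (Hft : start s t <= f t) by (destruct f_profile as (Hf & _); apply Hf, Ht).
  unfold report_list. unfold regs at 1. do 3 sym1. eapply ok_mono.
  { apply (ok_while A B _ _ (fun j st => exists x, st = Mem (regs t x) h
        (map with_sum (prefix_cells s f t ++ map (cell s t) (seq (start s t) (x - start s t))))
        /\ j = f t - x /\ start s t <= x <= f t) 2) with (n := f t - start s t).
    - clear x. intros j' l h' o' (x & [= -> -> ->] & -> & Hx) Hb. unfold regs in Hb. ev.
      rewrite He in Hb. exists (f t - S x). split; [lia|].
      sym1. apply ok_print. sym1. split; [|lia].
      exists (x + 1). split; [|lia]. f_equal.
      replace (x + 1 - start s t) with (S (x - start s t)) by lia.
      rewrite seq_S, !map_app, <- app_assoc. do 2 f_equal. simpl.
      replace (start s t + (x - start s t)) with x by lia.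
      rewrite <- Hcell. reflexivity.
    - rewrite Hs. exists (start s t). rewrite Nat.sub_diag. simpl. rewrite app_nil_r.
      split; [reflexivity|lia]. }
  intros st d ((j' & x' & -> & Hj & Hx) & Hb & Hd). unfold regs in Hb. ev.
  rewrite He in Hb. assert (x' = f t) by lia. subst x'.
  sym1. split; [lia|]. exists (f t). rewrite prefix_cells_succ, Nat.add_1_r. reflexivity.
Qed.

(** The cost is amortized: one pass costs a constant plus 3 per printed cell, so both loops use the
    rule that tracks the time spent, and the printed cells add up to [k]. *)
Lemma report_ok :
  forall t x, ok A B report_prog (Mem (regs t x) h []) (fun st d => d <= 12 * s + 3 * k + 4 /\
    ou st = map with_sum (prefix_cells s f m)).
Proof.
  intros t x. unfold report_prog. do 3 sym1.
  eapply ok_mono.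
  { apply (ok_while_spent A B _ _ (fun st d => exists t x,
        st = Mem (regs t x) h (map with_sum (prefix_cells s f t)) /\ t <= nr /\
        d <= 4 * t + 3 * length (prefix_cells s f t)) (fun st => nr - nth 12 (sv st) 0)).
    - clear t x. intros l h' o d (t & x & [= -> -> ->] & Ht & Hd) Hb. unfold regs in Hb. ev.
      eapply ok_mono; [apply report_list_ok; [lia|auto|]|].
      + intros x'. unfold cell. rewrite (proj2 (Nat.ltb_lt t s)) by lia. reflexivity.
      + intros st d' (Hd' & x' & ->). unfold regs. ev. split; [|lia].
        exists (S t), x'. split; [reflexivity|]. split; [lia|].
        rewrite prefix_cells_succ, length_app, length_map, length_seq. lia.
    - exists 0, x. split; [reflexivity|]. lia. }
  clear t x. intros st d (d1 & -> & (t & x & -> & Ht & Hd1) & Hb). unfold regs in Hb. ev.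
  assert (t = nr) by lia. subst t. rewrite <- prefix_cells_nr in *. unfold regs.
  do 2 sym1. eapply ok_mono.
  { apply (ok_while_spent A B _ _ (fun st d => exists t x,
        st = Mem (regs t x) h (map with_sum (prefix_cells s f t)) /\ s <= t <= m /\
        (* The row cells were paid for by the first loop, so they are credited here. *)
        d + 3 * length (prefix_cells s f s) <= 4 * t + 3 * length (prefix_cells s f t))
        (fun st => m - nth 12 (sv st) 0)).
    - clear x. intros l h' o d (t & x & [= -> -> ->] & Ht' & Hd) Hb'. unfold regs in Hb'. ev.
      assert (Hft : start s t <= f t <= n) by (destruct f_profile as (Hf & _); apply Hf; lia).
      assert (Hst : start s t = s).
      { unfold start. rewrite (proj2 (Nat.ltb_ge t s)) by lia. reflexivity. }
      eapply ok_mono; [apply report_list_ok; [lia|lia|]|].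
      + intros x'. unfold cell. rewrite (proj2 (Nat.ltb_ge t s)) by lia. reflexivity.
      + intros st d' (Hd' & x' & ->). unfold regs. ev. split; [|lia].
        exists (S t), x'. split; [reflexivity|]. split; [lia|].
        rewrite prefix_cells_succ, length_app, length_map, length_seq. lia.
    - exists s, x. split; [reflexivity|]. split; [lia|]. lia. }
  intros st d (d2 & -> & (t & x' & -> & Ht' & Hd2) & Hb'). unfold regs in Hb'. ev.
  assert (t = m) by lia. subst t. split; [|reflexivity].
  assert (Hlen : length (prefix_cells s f m) = k).
  { rewrite length_prefix_cells. apply f_profile. }
  lia.
Qed.

End Report.

(** * Assembly of the machine-level statement *)

Lemma reports_cells A B s f :
  reports A B (selected s f) (map (with_sum A B) (prefix_cells s f (2 * s))).
Proof.
  assert (Hin : forall i j, In (i, j) (prefix_cells s f (2 * s)) <-> selected s f i j).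
  { intros i j. rewrite in_prefix_cells, selected_cell. reflexivity. }
  split; [|split].
  - rewrite map_map. simpl. rewrite map_id. apply NoDup_prefix_cells.
  - intros i j v Hv. apply in_map_iff in Hv. destruct Hv as ([i' j'] & [= -> -> <-] & Hp).
    split; [apply Hin, Hp|reflexivity].
  - intros i j Hij. exists (A i + B j)%R. apply in_map_iff. exists (i, j).
    split; [reflexivity|apply Hin, Hij].
Qed.

Lemma is_topk_ext n k A B (S S' : nat -> nat -> Prop) :
  (forall i j, S' i j <-> S i j) -> is_topk n k A B S -> is_topk n k A B S'.
Proof.
  intros Heq (H1 & (L & H2 & H3 & H4) & H5). split; [|split].
  - intros i j Hij. apply H1, Heq, Hij.
  - exists L. split; [assumption|]. split; [assumption|]. intros p. rewrite Heq. apply H4.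
  - intros i j i' j' Hij Hi' Hj' Hn. apply H5; auto; rewrite <- Heq; assumption.
Qed.

Lemma reports_ext A B (S S' : nat -> nat -> Prop) o :
  (forall i j, S' i j <-> S i j) -> reports A B S o -> reports A B S' o.
Proof.
  intros Heq (H1 & H2 & H3). split; [assumption|split].
  - intros i j v Hv. rewrite Heq. apply H2, Hv.
  - intros i j Hij. apply H3, Heq, Hij.
Qed.

Lemma compile_run A B c st t st' N Rg : exec A B c st t st' -> wf_cmd c = true ->
  rel (sv st) (hp st) N ->
  exists T N' Rg', T <= clen c * t
    /\ run (compile c 0) A B T (mkState 0 N Rg (ou st)) = mkState (clen c) N' Rg' (ou st')
    /\ rel (sv st') (hp st') N'.
Proof.
  intros He Hw Hr.
  exact (compile_ok (compile c 0) A B c st t st' He Hw 0 N Rg (clen c)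
           (fun i x Hx => Hx) Hr (le_n _)).
Qed.

Lemma compile_halted c N Rg o : halted (compile c 0) (mkState (clen c) N Rg o).
Proof.
  unfold halted. rewrite (proj2 (nth_error_None _ _)); [exact I|].
  rewrite length_compile. reflexivity.
Qed.

Lemma select_ok n k s A B f :
  sorted_noninc n A -> sorted_noninc n B -> 1 <= s -> s <= n ->
  s * s <= k < S s * S s -> profile n s A B f k ->
  ok A B select_prog
    (Mem [n; k; 0; 0; 0; 0; 0; 0; 0; 0; 0; 0; 0; 0; 0; 0; 0; 0; 0; 0; 0; 0] (fun _ => 0) [])
    (fun st d => d <= 1000 * (s * Nat.log2 k ^ 3 + 1) /\
    exists nr w q t v x y px py ix jx iy jy h,
      st = Mem [n; k; 0; nr; 0; s; 64; 64 + 2 * s; s; 2 * s; w; q; t; v; x; y;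
                px; py; ix; jx; iy; jy] h []
      /\ nr <= s /\ (forall u, u < nr -> 0 < f u) /\ (forall u, nr <= u < s -> f u = 0)
      /\ forall u, u < 2 * s -> h (2 * u) = start s u /\ h (2 * u + 1) = f u - 1).
Proof.
  intros HA HB Hs1 Hsn Hsk Hf. unfold select_prog.
  set (lg := Nat.log2 k).
  assert (Hk : k < 2 ^ S lg) by (apply Nat.log2_spec; nia).
  assert (Hstart : forall u, u < 2 * s -> start s u <= start s u <= f u).
  { intros u Hu. split; [lia|]. destruct Hf as (Hf & _). apply Hf, Hu. }
  apply ok_seq. eapply ok_mono; [eapply setup_ok; eassumption|].
  intros st1 d1 (Hd1 & t1 & v1 & h1 & Hw1 & Hl1 & Hlv1).
  apply ok_seq. eapply ok_mono.
  { eapply (phases_ok n k s A B f) with (J := S lg) (lo := start s); try eassumption.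
    - split; [exact Hstart|]. apply Hf.
    - reflexivity.
    - fold lg. nia. }
  intros st2 d2 (Hd2 & w2 & t2 & v2 & h2 & lo & Hw2 & Hl2 & Hlo & Hsum).
  (* The distances to [f] sum to 0, so each of them is 0. *)
  assert (Heq : forall u, u < 2 * s -> lo u = f u).
  { intros u Hu.
    assert (Hz : 0 = f u - lo u).
    { apply (sumf_le_eq (fun _ => 0) (fun u => f u - lo u) (2 * s)); [lia|lia|assumption]. }
    specialize (Hlo u Hu). lia. }
  eapply ok_mono.
  { eapply (encode_ok n k s A B f); try eassumption.
    intros u Hu. rewrite <- Heq by assumption. apply Hl2, Hu. }
  intros st3 d3 (Hd3 & Hst3). split; [|exact Hst3].
  assert (Hdepth : depth s <= lg + 2).
  { unfold depth. assert (Nat.log2 (2 * s) <= S lg); [|lia].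
    rewrite Nat.log2_double by lia. apply le_n_S, Nat.log2_le_mono. nia. }
  fold lg in Hd1. assert (Hslg : s < 2 ^ S lg) by nia.
  clearbody lg. clear - Hd1 Hd2 Hd3 Hdepth Hs1 Hslg.
  assert (Hph : d2 <= (22 * (2 * s) + 8 + (22 * (lg + 2) + 6) * (2 * s) + 1) * S lg + 1).
  { etransitivity; [exact Hd2|]. apply Nat.add_le_mono_r, Nat.mul_le_mono_r.
    apply Nat.add_le_mono_r, Nat.add_le_mono_l, Nat.mul_le_mono_r. lia. }
  (* For [lg = 0] the main term vanishes, but then [s = 1] and the summand 1 of the bound covers the
     constant cost. Otherwise lower powers of [lg] are absorbed by the cube. *)
  destruct (Nat.eq_dec lg 0) as [->|Hlg].
  { simpl in Hslg. replace (0 ^ 3) with 0 by reflexivity. lia. }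
  assert (Hle : forall a, a <= a * lg).
  { intros a. rewrite <- (Nat.mul_1_r a) at 1. apply Nat.mul_le_mono_l. lia. }
  assert (Hs3 : s * lg * lg <= s * lg ^ 3).
  { replace (s * lg ^ 3) with (s * lg * lg * lg) by (simpl; ring). apply Hle. }
  pose proof (Hle (s * lg)) as Hs2. pose proof (Hle s) as Hs0.
  assert (Hlg' : lg <= s * lg) by nia.
  generalize dependent (s * lg ^ 3). intros a Ha. lia.
Qed.

Theorem theorem1 :
  exists (P1 P2 : program) (c : nat),
    forall (n k : nat) (A B : nat -> R),
      sorted_noninc n A -> sorted_noninc n B ->
      (1 <= k <= n * n)%nat ->
      exists t1 : nat,
        (t1 <= c * (Nat.sqrt k * Nat.log2 k ^ 3 + 1))%nat /\
        halted P1 (run P1 A B t1 (init n k)) /\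
        staircase_wf (run P1 A B t1 (init n k)) /\
        (st_nr (run P1 A B t1 (init n k)) + st_nc (run P1 A B t1 (init n k))
           <= c * (Nat.sqrt k + 1))%nat /\
        is_topk n k A B (stair_set (run P1 A B t1 (init n k))) /\
        exists t2 : nat,
          (t2 <= c * k)%nat /\
          halted P2 (run P2 A B t2 (restart (run P1 A B t1 (init n k)))) /\
          reports A B (stair_set (run P1 A B t1 (init n k)))
            (out (run P2 A B t2 (restart (run P1 A B t1 (init n k))))).
Proof.
  exists (compile select_prog 0), (compile report_prog 0),
    (* The summands pay for the selection, the report, and the at most [2 * s] described rows and
       columns. *)
    (1000 * clen select_prog + 20 * clen report_prog + 2).
  remember (clen select_prog) as L1 eqn:EL1.
  remember (clen report_prog) as L2 eqn:EL2.
  intros n k A B HA HB Hk. set (s := Nat.sqrt k).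
  assert (Hsk : s * s <= k < S s * S s) by (apply Nat.sqrt_spec; lia).
  assert (Hs1 : 1 <= s) by nia. assert (Hsn : s <= n) by nia.
  destruct (exists_profile n s A B HA HB Hs1 Hsn k) as (f & Hf).
  (* The lists hold enough cells: for [n = s] they cover the whole matrix, and for [n > s] they have
     at least [s * s + 2 * s] cells. *)
  { destruct (Nat.eq_dec n s) as [->|]; nia. }
  destruct (select_ok n k s A B f HA HB Hs1 Hsn Hsk Hf)
    as (d1 & st1 & He1 & Hd1 & nr & w & q & t & v & x & y & px & py & ix & jx & iy & jy & h
        & -> & Hnr & Hpos & Hzero & Hh).
  destruct (compile_run A B _ _ _ _
    (fun r => if Nat.eqb r 0 then n else if Nat.eqb r 1 then k else 0) (fun _ => 0%R)
    He1 eq_refl) as (T1 & N1 & Rg1 & HT1 & HR1 & Hrel1).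
  (* The 22 listed scalars agree with the initial registers, and padding with zeros covers the
     rest. *)
  { split; intros r; [intros _|reflexivity]. do 22 (destruct r as [|r]; [reflexivity|]).
    destruct r; reflexivity. }
  rewrite <- EL1 in *. exists T1. unfold init. cbn [ou] in HR1. rewrite HR1.
  cbn [sv hp] in Hrel1. destruct (Hrel1) as [HN HH].
  unfold staircase_wf, stair_set, st_nr, st_nc, st_r0, st_c0, row_start, row_end,
    col_start, col_end. cbn [nm restart Defs.rm].
  rewrite !(HN 2), !(HN 3), !(HN 4), !(HN 5), !(HN 6), !(HN 7) by lia. cbn [nth].
  assert (Hrow : forall u, u < s ->
    N1 (64 + 2 * u) = start s u /\ N1 (64 + 2 * u + 1) = f u - 1).
  { intros u Hu. rewrite <- Nat.add_assoc, !HH. apply Hh. lia. }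
  assert (Hcol : forall u, u < s ->
    N1 (64 + 2 * s + 2 * u) = start s (s + u) /\ N1 (64 + 2 * s + 2 * u + 1) = f (s + u) - 1).
  { intros u Hu. replace (64 + 2 * s + 2 * u) with (64 + 2 * (s + u)) by lia.
    rewrite <- Nat.add_assoc, !HH. apply Hh. lia. }
  assert (Hst0 : forall u, u < s -> start s u = 0).
  { intros u Hu. unfold start. rewrite (proj2 (Nat.ltb_lt u s) Hu). reflexivity. }
  assert (Hsts : forall u, start s (s + u) = s).
  { intros u. unfold start. rewrite (proj2 (Nat.ltb_ge (s + u) s)) by lia. reflexivity. }
  assert (Hfs : forall u, u < 2 * s -> start s u <= f u <= n) by apply Hf.
  assert (Hsel : forall i j,
    (exists t0, t0 < nr /\ i = 0 + t0 /\ N1 (64 + 2 * t0) <= j <= N1 (64 + 2 * t0 + 1)) \/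
    (exists t0, t0 < s /\ j = 0 + t0 /\
       N1 (64 + 2 * s + 2 * t0) <= i <= N1 (64 + 2 * s + 2 * t0 + 1)) <->
    selected s f i j).
  { intros i j. unfold selected. split.
    - intros [(u & Hu & -> & Hj)|(u & Hu & -> & Hi)].
      + left. rewrite (proj1 (Hrow u ltac:(lia))), (proj2 (Hrow u ltac:(lia))) in Hj.
        specialize (Hpos u Hu). simpl. lia.
      + right. rewrite (proj1 (Hcol u Hu)), (proj2 (Hcol u Hu)), Hsts in Hi.
        simpl. lia.
    - intros [[Hi Hj]|[Hj Hi]].
      + left. exists i. rewrite (proj1 (Hrow i Hi)), (proj2 (Hrow i Hi)), Hst0 by assumption.
        destruct (le_lt_dec nr i) as [Hge|]; [rewrite Hzero in Hj by lia; lia|lia].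
      + right. exists j. rewrite (proj1 (Hcol j Hj)), (proj2 (Hcol j Hj)), Hsts. lia. }
  split; [nia|]. split; [subst L1; apply compile_halted|]. split.
  { split; intros u Hu.
    - rewrite (proj1 (Hrow u ltac:(lia))), (proj2 (Hrow u ltac:(lia))),
        (proj1 (Hrow (S u) ltac:(lia))), (proj2 (Hrow (S u) ltac:(lia))), !Hst0 by lia.
      assert (f (S u) <= f u); [|lia].
      eapply profile_rows with (n := n) (s := s) (A := A) (B := B) (q := k); eauto; lia.
    - rewrite (proj1 (Hcol u ltac:(lia))), (proj2 (Hcol u ltac:(lia))),
        (proj1 (Hcol (S u) ltac:(lia))), (proj2 (Hcol (S u) ltac:(lia))), !Hsts by lia.
      assert (f (s + S u) <= f (s + u)); [|lia].
      eapply profile_cols with (n := n) (s := s) (A := A) (B := B) (q := k); eauto; lia. }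
  split; [nia|]. split.
  { eapply is_topk_ext; [exact Hsel|].
    eapply profile_topk; eauto; lia. }
  destruct (report_ok n k s A B f Hs1 Hf nr w q v y px py ix jx iy jy h Hnr Hpos Hzero Hh t x)
    as (d2 & st2 & He2 & Hd2 & Hout).
  destruct (compile_run A B _ _ _ _ N1 Rg1 He2 eq_refl Hrel1) as (T2 & N2 & Rg2 & HT2 & HR2 & _).
  rewrite <- EL2 in *. exists T2. cbn [ou] in HR2. unfold restart. cbn [nm Defs.rm]. rewrite HR2.
  assert (Hd2' : d2 <= 20 * k) by nia.
  pose proof (Nat.mul_le_mono_l _ _ L2 Hd2').
  split; [nia|]. split; [subst L2; apply compile_halted|].
  eapply reports_ext; [exact Hsel|]. cbn [out]. rewrite Hout. apply reports_cells.
Qed.
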